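(* Let $\mathbb K$ be an algebraically closed field and let $A=\mathbb K\langle x,y\rangle$ be the free noncommutative associative algebra generated (in degree one) by $x,y$, with homogeneous components $A(k)$. Let $d\ge 50$ be an integer and let $(D(k))_{k\in\mathbb N}$ be a sequence of linear subspaces $D(k)\subseteq A(k)$ such that (1) $D(k)=0$ whenever $k\ge 2$ and $k/\log k<18d$; (2) $D(k)=0$ whenever $2^n-2^{n-3}<k\le 2^n+2^{n-1}$ for some $n\in\mathbb N$; (3) $D(k)=0$ whenever there exist $j,n\in\mathbb N$ such that $D(j)\ne 0$ and $j<2^n<k<\max\{j^{1000},12dnj\}$; (4) $\dim D(k)\le k^d$ for all $k\in\mathbb N$. Then there is a surjective $\mathbb K$-algebra homomorphism from $A/\langle D(k)\colon k\in\mathbb N\rangle$ onto an infinite dimensional algebra with Gelfand-Kirillov dimension at most $45d$.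
   Context: $\mathbb N=\{0,1,2,\dots\}$ and $\log$ is the logarithm in base $2$. $A(k)$ is the $\mathbb K$-span of the words of length $k$ in $x,y$. $\langle D(k)\colon k\in\mathbb N\rangle$ is the two-sided ideal of $A$ generated by all the $D(k)$. For an algebra $R$ generated by a finite dimensional subspace $S$, put $v(n)=\dim(1+S+S^2+\cdots+S^n)$; the Gelfand-Kirillov dimension of $R$ is the infimum of the $c$ such that $v(n)\precsim n^c$, where $v\precsim v'$ means $v(n)\le v'(Cn)$ for some constant $C$ and all $n\ge1$ (it does not depend on the choice of $S$). *)

(* Defs.v *)
From HB Require Import structures.
From mathcomp Require Export all_boot all_order all_algebra.
From mathcomp Require Export boolp classical_sets reals constructive_ereal ereal exp.
(* The notations of monalg clash with those of the analysis library. *)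
From mathcomp Require Export -(notations) monalg.

Set Implicit Arguments.
Unset Strict Implicit.
Unset Printing Implicit Defensive.

Import Order.TTheory GRing.Theory Num.Theory.
Local Open Scope classical_set_scope.
Local Open Scope ring_scope.

Section LinearAlgebra.
Context {K : pzRingType} {V : lmodType K}.

Definition lin_span (X : set V) : set V :=
  smallest (fun W : set V => GRing.submod_closed [in W]) X.

Definition lin_indep n (b : 'I_n -> V) : Prop :=
  forall a : 'I_n -> K, \sum_(i < n) a i *: b i = 0 -> forall i, a i = 0.

Definition has_dim (W : set V) (n : nat) : Prop :=
  exists b : 'I_n -> V, lin_indep b /\ lin_span (range b) = W.

Definition finite_dim (W : set V) : Prop := exists n, has_dim W n.

(* Meaningful only for a finite dimensional subspace W (0 otherwise). *)
Definition dim (W : set V) : nat := xget 0%N [set n | has_dim W n].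

End LinearAlgebra.

Section TwoSidedIdeals.
Context {A : pzRingType}.

Definition two_sided_ideal (I : set A) : Prop :=
  GRing.zmod_closed [in I] /\ forall a x b, I x -> I (a * x * b).

Definition ideal_gen (X : set A) : set A := smallest two_sided_ideal X.

Lemma ideal_genP (X : set A) : two_sided_ideal (ideal_gen X).
Proof.
split; last by move=> a x b Ix M [idM XM]; apply: idM.2; apply: Ix.
split=> [|x y /set_mem Ix /set_mem Iy]; apply/mem_set=> M [idM XM].
  by apply/set_mem; apply: idM.1.1.
by apply/set_mem; apply: idM.1.2; apply/mem_set; [exact: Ix|exact: Iy].
Qed.

Definition ideal_pred (X : set A) : {pred A} := [in ideal_gen X].

HB.instance Definition _ (X : set A) :=
  GRing.isZmodClosed.Build A (ideal_pred X) (ideal_genP X).1.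

Lemma ideal_predM (X : set A) a x b :
  x \in ideal_pred X -> a * x * b \in ideal_pred X.
Proof. by move=> /set_mem Ix; apply/mem_set; apply: (ideal_genP X).2. Qed.

Lemma ideal_predMl (X : set A) a x :
  x \in ideal_pred X -> a * x \in ideal_pred X.
Proof. by move=> Ix; rewrite -[a * x]mulr1 ideal_predM. Qed.

Lemma ideal_predMr (X : set A) x b :
  x \in ideal_pred X -> x * b \in ideal_pred X.
Proof. by move=> Ix; rewrite -[x]mul1r ideal_predM. Qed.

End TwoSidedIdeals.

(* The library puts a ring structure only on quotients of commutative rings,
   and its lalgType/algType are nonzero rings, whereas A/<X> may vanish; hence
   the quotient is equipped with a pzRingType and an lmodType structure. *)
Section QuotientAlgebra.
Local Open Scope quotient_scope.
Context (K : pzRingType) (A : lalgType K) (X : set A).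

Definition quot_alg := {ideal_quot (ideal_pred X : zmodClosed A)}.

HB.instance Definition _ := GRing.Zmodule.on quot_alg.
HB.instance Definition _ := EqQuotient.on quot_alg.

Local Notation Q := quot_alg.

Lemma quot_algP (x y : A) :
  reflect (\pi_Q x = \pi_Q y) (x - y \in ideal_pred X).
Proof. by rewrite (Quotient.idealrBE (ideal_pred X)); exact: eqP. Qed.

Definition quot_one : Q := \pi_Q 1.
Definition quot_mul (x y : Q) : Q := \pi_Q (repr x * repr y).
Definition quot_scale (k : K) (x : Q) : Q := \pi_Q (k *: repr x).

Lemma pi_quotD (x y : A) : \pi_Q (x + y) = \pi_Q x + \pi_Q y.
Proof. by rewrite /Q !piE. Qed.

Lemma pi_quotM (x y : A) : \pi_Q (x * y) = quot_mul (\pi_Q x) (\pi_Q y).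
Proof.
rewrite /quot_mul; set x' := repr (\pi_Q x); set y' := repr (\pi_Q y).
have Ix : x - x' \in ideal_pred X by apply/quot_algP; rewrite /x' reprK.
have Iy : y - y' \in ideal_pred X by apply/quot_algP; rewrite /y' reprK.
apply/quot_algP; have -> : x * y - x' * y' = (x - x') * y + x' * (y - y').
  by rewrite mulrBl mulrBr addrA subrK.
by apply: rpredD; [exact: ideal_predMr|exact: ideal_predMl].
Qed.

Lemma pi_quotZ k (x : A) : \pi_Q (k *: x) = quot_scale k (\pi_Q x).
Proof.
apply/quot_algP; rewrite -scalerBr -mulr_algl ideal_predMl//.
by apply/quot_algP; rewrite reprK.
Qed.

Lemma quot_mulA : associative quot_mul.
Proof.
elim/quotW=> x; elim/quotW=> y; elim/quotW=> z.
by rewrite -(pi_quotM y z) -(pi_quotM x y) -(pi_quotM x) -(pi_quotM _ z) mulrA.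
Qed.

Lemma quot_mul1l : left_id quot_one quot_mul.
Proof. by elim/quotW=> x; rewrite -pi_quotM mul1r. Qed.

Lemma quot_mul1r : right_id quot_one quot_mul.
Proof. by elim/quotW=> x; rewrite -pi_quotM mulr1. Qed.

Lemma quot_mulDl : left_distributive quot_mul +%R.
Proof.
elim/quotW=> x; elim/quotW=> y; elim/quotW=> z.
by rewrite -pi_quotD -(pi_quotM x z) -(pi_quotM y z) -pi_quotM mulrDl pi_quotD.
Qed.

Lemma quot_mulDr : right_distributive quot_mul +%R.
Proof.
elim/quotW=> x; elim/quotW=> y; elim/quotW=> z.
by rewrite -pi_quotD -(pi_quotM x y) -(pi_quotM x z) -pi_quotM mulrDr pi_quotD.
Qed.

HB.instance Definition _ := GRing.Zmodule_isPzRing.Build quot_alg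
  quot_mulA quot_mul1l quot_mul1r quot_mulDl quot_mulDr.

Lemma quot_scaleA a b (x : Q) :
  quot_scale a (quot_scale b x) = quot_scale (a * b) x.
Proof. by elim/quotW: x => x; rewrite -(pi_quotZ b) -(pi_quotZ a) -pi_quotZ scalerA. Qed.

Lemma quot_scale1 : left_id 1 quot_scale.
Proof. by elim/quotW=> x; rewrite -pi_quotZ scale1r. Qed.

Lemma quot_scaleDr : right_distributive quot_scale +%R.
Proof.
move=> a; elim/quotW=> x; elim/quotW=> y.
by rewrite -pi_quotD -(pi_quotZ a x) -(pi_quotZ a y) -pi_quotZ scalerDr pi_quotD.
Qed.

Lemma quot_scaleDl (x : Q) : {morph quot_scale^~ x : a b / a + b}.
Proof.
by elim/quotW: x => x a b; rewrite -(pi_quotZ a) -(pi_quotZ b) -pi_quotZ scalerDl pi_quotD.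
Qed.

HB.instance Definition _ := GRing.Zmodule_isLmodule.Build K quot_alg
  quot_scaleA quot_scale1 quot_scaleDr quot_scaleDl.

Lemma pi_quot_linear : linear (\pi_Q : A -> Q).
Proof. by move=> a x y; rewrite pi_quotD pi_quotZ. Qed.

Lemma pi_quot_monoid_morphism : monoid_morphism (\pi_Q : A -> Q).
Proof. by split=> // x y; rewrite pi_quotM. Qed.

End QuotientAlgebra.

Section GelfandKirillov.
Context (R : realType) {K : pzRingType} {B : algType K}.
Implicit Type S : set B.

Definition mul_space (U W : set B) : set B :=
  lin_span [set u * w | u in U & w in W].

Definition pow_space S (n : nat) : set B :=
  iter n (mul_space S) (lin_span [set 1]).

Definition generating_space S : Prop :=
  finite_dim S /\
  smallest (fun W : set B => GRing.subalg_closed [in W]) S = setT.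

Definition growth S (n : nat) : nat :=
  dim (lin_span (\bigcup_(i < n.+1) pow_space S i)).

Definition growth_le (v v' : nat -> R) : Prop :=
  exists2 C : nat, (0 < C)%N & forall n, (1 <= n)%N -> v n <= v' (C * n)%N.

Definition growth_exponent S : \bar R :=
  ereal_inf [set c%:E | c in
    [set c : R | growth_le (fun n => (growth S n)%:R) (fun n => n%:R `^ c)]].

End GelfandKirillov.

(* An arbitrary finite dimensional generating space is selected: the growth
   exponent does not depend on it. The value is meaningful only for a finitely
   generated algebra. *)
Definition GKdim (R : realType) (K : pzRingType) (B : algType K) : \bar R :=
  growth_exponent R (xget set0 [set S : set B | generating_space S]).

(* fmonom 'I_2 is the free monoid of words in two letters and malg (fmonom 'I_2)
   K its monoid algebra over K. *)
Definition free_alg2 (K : nzRingType) : lalgType K := malg (fmonom 'I_2) K.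

Definition word_space (K : nzRingType) (k : nat) : set (free_alg2 K) :=
  lin_span [set mkmalgU w 1 | w in [set w : fmonom 'I_2 | fdeg w = k]].

Arguments word_space K k : clear implicits.

Definition log2 (R : realType) (x : R) : R := ln x / ln 2.

(* Main.v *)
(* Idea. For every N choose a short list P_N of linear functionals on A(2^N) such
   that P_(N+1) lies in the span of the products f (x) g with f, g in P_N. The
   elements r with f(g r h) = 0 for all N, all f in P_N and all g, h form an ideal,
   and the restrictions of members of any P_N to a window of length at most 2^m
   are spanned, for each way of cutting the window in two, by at most
   (2 |P_0| ... |P_(m-1)|)^2 functionals; this bounds the growth of the quotient.
   If P_N = [a; b], then normally P_(N+1) = [a (x) a; a (x) b]. When D(k) <> 0 for
   some k in (12 * 2^(n-3), 14 * 2^(n-3)], the lists are instead squared,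
   P_(s+1) = P_s (x) P_s, on an interval start n <= s < n - 1 just long enough that
   the number of linear conditions imposed by these D(k) is less than the number
   of words in a, b available at the end. One then chooses Q and q among the
   combinations of such words so that every window of length k of the periodic
   pattern Q a..a q a..a kills D(k). Q is chosen first, against all possible q, and
   q next, for the given Q, so that all the conditions are linear. *)
From HB Require Import structures.
Require Import Defs.
From mathcomp Require Import zify lra.

Set Implicit Arguments.
Unset Strict Implicit.
Unset Printing Implicit Defensive.

Import Order.TTheory GRing.Theory Num.Theory.
Local Open Scope classical_set_scope.
Local Open Scope ring_scope.

(** * Functionals on words *)

(** The length of the squaring interval is a compromise. With [u] for [2 ^ log_unit n], it produces
    words of [8 * u] cells, and each of the two selections keeps [u] letters of freedom, so [2 ^ u]
    must exceed the number of conditions: at most [k ^ d] relators for each [k < 2 ^ n.+1], times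
    the offsets inside a cell, times the functionals needed for the two cells that a window cuts,
    times the positions in the period. The relators alone account for about [2 ^ (d * n)], whence
    the threshold [9 * d * n / 7] for [u]. Growth pays for this: the logarithms of the list sizes
    add up to about [8 * u < 144 * d * n / 7] at level [n], below [22 * d * n] with all the rest,
    and the two sides of a cut double this to [44 * d]; hence [45 * d]. Blocks of [8 * u] cells must
    fit into [2 ^ n] letters, which the constant [18 * d] of hypothesis (1) provides. The power 1000
    in hypothesis (3) keeps earlier stages from adding more than [d * n / 20] to the exponent of a
    cut cell. Hypothesis (2) leaves lengths between 3/2 and 7/4 of [2 ^ n], for which every window
    contains a full Q or a full q. *)

Notation word := (seq 'I_2).

Section Functionals.
Context {K : fieldType}.
Notation functional := (word -> K).
Implicit Types (l m n : nat) (f g h : functional) (L M : seq functional) (x y u w : word).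

(** An element of degree [l] is identified with its coefficient function, so relators and
    functionals have the same type and can exchange roles. *)
Definition pairing l (r f : functional) : K :=
  \sum_(u : l.-tuple 'I_2) r u * f u.

Lemma pairing_ext l r f g : (forall u, size u = l -> f u = g u) ->
  pairing l r f = pairing l r g.
Proof. by move=> fg; apply: eq_bigr => u _; rewrite fg ?size_tuple. Qed.

Lemma pairing_lin l r a f g :
  pairing l r (fun u => a * f u + g u) = a * pairing l r f + pairing l r g.
Proof.
rewrite /pairing big_distrr -big_split /=; apply: eq_bigr => u _.
by rewrite mulrDr mulrCA.
Qed.

(* Only the values on words of length l matter: span l L f holds if f agrees
   there with a linear combination of members of L. *)
Inductive span l L : functional -> Prop :=
| span_zero f : (forall u, size u = l -> f u = 0) -> span l L f
| span_cons a g h f : g \in L -> span l L h ->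
    (forall u, size u = l -> f u = a * g u + h u) -> span l L f.

Lemma span_ext l L f g : span l L f -> (forall u, size u = l -> g u = f u) ->
  span l L g.
Proof.
case=> [f0 f00|a g0 h f0 g0L hL E] fg; first by apply: span_zero => u lu; rewrite fg ?f00.
by apply: (span_cons g0L hL (a := a)) => u lu; rewrite fg ?E.
Qed.

Lemma span_mem l L f : f \in L -> span l L f.
Proof.
move=> fL; apply: (span_cons (a := 1) fL (span_zero (f := fun=> 0) _ _)) => // u _.
by rewrite mul1r addr0.
Qed.

Lemma span_lin l L a f g : span l L f -> span l L g ->
  span l L (fun u => a * f u + g u).
Proof.
move=> sf sg; elim: sf => {f} [f f0|b g0 h f g0L _ IH E].
  by apply: (span_ext sg) => u lu; rewrite f0 // mulr0 add0r.
by apply: (span_cons g0L IH (a := a * b)) => u lu; rewrite E // mulrDr mulrA addrA.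
Qed.

Lemma span_scale l L a f : span l L f -> span l L (fun u => a * f u).
Proof.
move=> sf; apply: (span_ext (span_lin a sf (span_zero (f := fun=> 0) _ _))) => // u _.
by rewrite addr0.
Qed.

Lemma span_scaler l L a f : span l L f -> span l L (fun u => f u * a).
Proof. by move=> sf; apply: (span_ext (span_scale a sf)) => u _; rewrite mulrC. Qed.

Lemma span_sum l L (I : eqType) (s : seq I) (c : I -> K) (F : I -> functional) :
  (forall i, i \in s -> span l L (F i)) ->
  span l L (fun u => \sum_(i <- s) c i * F i u).
Proof.
elim: s => [|i s IH] sF; first by apply: span_zero => u _; rewrite big_nil.
have Hi : span l L (F i) by apply: sF; rewrite inE eqxx.
have Hs j : j \in s -> span l L (F j) by move=> js; apply: sF; rewrite inE js orbT.
by apply: (span_ext (span_lin (c i) Hi (IH Hs))) => u _; rewrite big_cons.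
Qed.

Lemma span_map l1 l2 L1 L2 (T : word -> word) (b : word -> K) f :
  (forall u, size u = l2 -> size (T u) = l1) ->
  (forall g, g \in L1 -> span l2 L2 (fun u => b u * g (T u))) ->
  span l1 L1 f -> span l2 L2 (fun u => b u * f (T u)).
Proof.
move=> sT H; elim=> {f} [f f0|a g h f gL _ IH E].
  by apply: span_zero => u /sT /f0 ->; rewrite mulr0.
apply: (span_ext (span_lin a (H g gL) IH)) => u /sT /E ->.
by rewrite mulrDr mulrCA.
Qed.

Lemma pairing_span l L r f : span l L f ->
  (forall g, g \in L -> pairing l r g = 0) -> pairing l r f = 0.
Proof.
move=> sf rL; elim: sf => {f} [f f0|a g h f gL _ IH E].
  by rewrite (pairing_ext _ f0) /pairing big1 // => u _; rewrite mulr0.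
by rewrite (pairing_ext _ E) pairing_lin rL // IH mulr0 addr0.
Qed.

Definition tens n f g : functional := fun u => f (take n u) * g (drop n u).

Definition tens_list n L M : seq functional := [seq tens n f g | f <- L, g <- M].

(** [minn] and truncated subtraction keep this true when [n] exceeds [l], so cuts outside the window
    need no separate treatment. *)
Lemma span_tens n l L M f g : span (minn l n) L f -> span (l - n) M g ->
  span l (tens_list n L M) (tens n f g).
Proof.
move=> sf sg.
have H h : h \in L -> span l (tens_list n L M) (tens n h g).
  move=> hL; apply: (@span_map (l - n) l M _ (drop n) (h \o take n)) sg => [u <-|k kM].
    by rewrite size_drop.
  by apply: span_mem; apply/allpairsP; exists (h, k).
suff: span l (tens_list n L M) (fun u => (g \o drop n) u * f (take n u)).
  by move/span_ext; apply => u _; rewrite mulrC.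
apply: (@span_map (minn l n) l L _ (take n) (g \o drop n)) sf => [u <-|h hL].
  by rewrite size_take_min minnC.
by apply: (span_ext (H h hL)) => u _; rewrite mulrC.
Qed.

Lemma tensA k m n f g h : k = (m + n)%N ->
  tens k (tens m f g) h = tens m f (tens n g h).
Proof.
move=> ->; apply/funext => w; rewrite /tens take_takel ?leq_addr // take_drop drop_drop mulrA.
by rewrite addnC.
Qed.

Lemma tens_catl n f g x u :
  tens n f g (x ++ u) =
  tens (n - size x) (fun v => f (take n x ++ v)) (fun v => g (drop n x ++ v)) u.
Proof.
rewrite /tens take_cat drop_cat; case: ltnP => [lt|le].
  by move/ltnW: lt; rewrite -subn_eq0 => /eqP ->; rewrite take0 drop0 cats0.
by rewrite (take_oversize le) (drop_oversize le).
Qed.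

Lemma tens_catr n f g u y :
  tens n f g (u ++ y) =
  tens n (fun v => f (v ++ take (n - size u) y)) (fun v => g (v ++ drop (n - size u) y)) u.
Proof.
rewrite /tens take_cat drop_cat; case: ltnP => [lt|le].
  by move/ltnW: lt; rewrite -subn_eq0 => /eqP ->; rewrite take0 drop0 cats0.
by rewrite (take_oversize le) (drop_oversize le).
Qed.

Definition suffixes_in n l L f := forall x, (size x + l)%N = n ->
  span l L (fun u => f (x ++ u)).

Definition prefixes_in n l L f := forall y, (l + size y)%N = n ->
  span l L (fun u => f (u ++ y)).

Lemma suffixes_tens n1 n2 l L M f g :
  (forall k, k = (l - n2)%N -> suffixes_in n1 k L f) ->
  (forall k, k = minn l n2 -> suffixes_in n2 k M g) ->
  suffixes_in (n1 + n2) l (tens_list (l - n2) L M) (tens n1 f g).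
Proof.
move=> sf sg x sx.
have E : (n1 - size x = l - n2)%N by lia.
apply: (span_ext (f := tens (l - n2) (fun v => f (take n1 x ++ v)) (fun v => g (drop n1 x ++ v)))).
  apply: span_tens.
    have -> : minn l (l - n2) = (l - n2)%N by lia.
    by apply: sf => //; rewrite size_take_min; lia.
  have -> : (l - (l - n2) = minn l n2)%N by lia.
  by apply: sg => //; rewrite size_drop; lia.
by move=> u _; rewrite tens_catl E.
Qed.

Lemma prefixes_tens n1 n2 l L M f g :
  (forall k, k = minn l n1 -> prefixes_in n1 k L f) ->
  (forall k, k = (l - n1)%N -> prefixes_in n2 k M g) ->
  prefixes_in (n1 + n2) l (tens_list n1 L M) (tens n1 f g).
Proof.
move=> pf pg y sy.
apply: (span_ext (f := tens n1 (fun v => f (v ++ take (n1 - l) y))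
  (fun v => g (v ++ drop (n1 - l) y)))).
  apply: span_tens; [apply: pf => //|apply: pg => //].
    by rewrite size_take_min; lia.
  by rewrite size_drop; lia.
by move=> u su; rewrite tens_catr su.
Qed.

Definition words n : seq word := [seq val t | t <- enum [set: n.-tuple 'I_2]%SET].

Lemma mem_words n w : (w \in words n) = (size w == n).
Proof.
apply/mapP/eqP => [[t _ ->]|sw]; first by rewrite size_tuple.
have H : size w == n by apply/eqP.
by exists (Tuple H); rewrite // mem_enum inE.
Qed.

Lemma size_words n : size (words n) = (2 ^ n)%N.
Proof. by rewrite size_map -cardE cardsT card_tuple card_ord. Qed.

Lemma uniq_words n : uniq (words n).
Proof. by rewrite map_inj_uniq ?enum_uniq //; exact: val_inj. Qed.

Lemma pairingE l r f : pairing l r f = \sum_(u <- words l) r u * f u.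
Proof.
rewrite /words big_map big_enum /= /pairing; apply: eq_bigl => u.
by rewrite inE.
Qed.

Definition delta v : functional := fun w => (w == v)%:R.
Definition deltas n : seq functional := [seq delta v | v <- words n].

Lemma span_deltas l f : span l (deltas l) f.
Proof.
apply: (span_ext (f := fun u => \sum_(v <- words l) f v * delta v u)).
  by apply: span_sum => v vl; apply: span_mem; apply: map_f.
move=> u su; rewrite (bigD1_seq u) ?mem_words ?su ?uniq_words //= big1.
  by rewrite /delta eqxx mulr1 addr0.
by move=> v /negPf vu; rewrite /delta eq_sym vu mulr0.
Qed.

Lemma big_words_cat m n (F : word -> K) :
  \sum_(w <- words (m + n)) F w = \sum_(u <- words m) \sum_(v <- words n) F (u ++ v).
Proof.
rewrite -(big_allpairs_dep (h := fun u v => u ++ v) (F := F)).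
apply: perm_big; apply: uniq_perm; first exact: uniq_words.
  apply: allpairs_uniq; rewrite ?uniq_words // => -[u v] [u' v'].
  move=> /allpairsP [[a b] /= [am bn [-> ->]]] /allpairsP [[a' b'] /= [am' bn' [-> ->]]] /= /eqP.
  move: am am'; rewrite !mem_words => /eqP am /eqP am'.
  by rewrite eqseq_cat ?am ?am' // => /andP [/eqP -> /eqP ->].
move=> w; rewrite mem_words; apply/eqP/allpairsP => [sw|[[u v] /= []]].
  exists (take m w, drop m w); rewrite /= !mem_words size_takel ?sw ?leq_addr //.
  by rewrite size_drop sw addKn cat_take_drop !eqxx.
by rewrite !mem_words => /eqP <- /eqP <- ->; rewrite size_cat.
Qed.

(** The linear condition that killing [r] imposes on the middle factor once the factors at the two
    ends are [f] and [g]. *)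
Definition contract l l' r f g : functional := fun w =>
  \sum_(u <- words l) \sum_(v <- words l') f u * g v * r (u ++ w ++ v).

Lemma pairing_tens3 l n l' r f X g :
  pairing (l + (n + l')) r (tens l f (tens n X g)) = pairing n (contract l l' r f g) X.
Proof.
rewrite !pairingE big_words_cat.
transitivity (\sum_(u <- words l) \sum_(w <- words n) \sum_(v <- words l')
  (f u * g v * r (u ++ w ++ v)) * X w).
  rewrite big_seq [RHS]big_seq; apply: eq_bigr => u.
  rewrite mem_words => /eqP su; rewrite big_words_cat big_seq [RHS]big_seq.
  apply: eq_bigr => w; rewrite mem_words => /eqP sw; apply: eq_bigr => v _.
  rewrite /tens take_size_cat // drop_size_cat // take_size_cat // drop_size_cat //.
  by rewrite [X w * _]mulrC [f u * (_ * _)]mulrA mulrA [r _ * _]mulrC.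
rewrite exchange_big /=; apply: eq_bigr => w _; rewrite /contract big_distrl /=.
by apply: eq_bigr => u _; rewrite big_distrl.
Qed.

Lemma window_tens l n l' n1 r A X C x y :
  (size x + l)%N = n1 ->
  pairing (l + (n + l')) r (fun z => tens n1 A (tens n X C) (x ++ z ++ y)) =
  pairing (l + (n + l')) r
    (tens l (fun u => A (x ++ u)) (tens n X (fun v => C (v ++ y)))).
Proof.
move=> sx; apply: pairing_ext => z sz; rewrite tens_catl.
have -> : (n1 - size x)%N = l by lia.
rewrite (take_oversize (n := n1)); last by lia.
rewrite (drop_oversize (n := n1)); last by lia.
rewrite /tens !cat0s take_cat drop_cat sz; case: ltnP => [lt|le].
  rewrite take_cat drop_cat size_drop sz; case: ltnP => [lt'|le'] //.
  have -> : (n - (l + (n + l') - l) = 0)%N by lia.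
  have sd : (size (drop l z) <= n)%N by rewrite size_drop sz.
  by rewrite take0 drop0 cats0 (take_oversize sd) (drop_oversize sd).
(* The window stops at the end of [A]. *)
have n0 : n = 0%N by lia. have l0 : l' = 0%N by lia.
rewrite n0 l0 !take0 !drop0.
have -> : (l - (l + (0 + 0)) = 0)%N by lia.
have sd : (size z <= l)%N by rewrite sz n0 l0 !addn0.
by rewrite take0 !drop0 !cats0 (take_oversize sd) (drop_oversize sd).
Qed.

(** The outer factors enter only through lists spanning their cut pieces, so a relator costs
    [size L * size M] linear conditions on [X]. All counting of conditions rests on this. *)
Lemma kill_window l n l' n1 r A X C x y L M :
  (size x + l)%N = n1 -> span l L (fun u => A (x ++ u)) ->
  span l' M (fun v => C (v ++ y)) ->
  (forall f g, f \in L -> g \in M -> pairing n (contract l l' r f g) X = 0) ->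
  pairing (l + (n + l')) r (fun z => tens n1 A (tens n X C) (x ++ z ++ y)) = 0.
Proof.
move=> sx sA sC H; rewrite window_tens //.
have S : span (l + (n + l')) (tens_list l L (tens_list n [:: X] M))
   (tens l (fun u => A (x ++ u)) (tens n X (fun v => C (v ++ y)))).
  apply: span_tens; first by rewrite (minn_idPr _) // leq_addr.
  rewrite addKn; apply: span_tens; first by apply: span_mem; rewrite inE.
  by rewrite addKn.
apply: (pairing_span S) => _ /allpairsP [[f h] /= [fL /allpairsP [[X' g] /= [XX gM ->]] ->]].
by move: XX; rewrite inE => /eqP ->; rewrite pairing_tens3 H.
Qed.

(** A linear system in [2 ^ n] unknowns. Two independent solutions are wanted because q must come in
    two versions, so that the level after a selection again has two members. *)
Lemma two_annihilated n (C : seq functional) : (size C + 2 <= 2 ^ n)%N ->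
  exists X1 X2 : functional,
    [/\ forall c, c \in C -> pairing n c X1 = 0,
        forall c, c \in C -> pairing n c X2 = 0 &
        forall a b, (forall w, size w = n -> a * X1 w + b * X2 w = 0) ->
          a = 0 /\ b = 0].
Proof.
move=> sC; set m := (2 ^ n)%N in sC *.
have sW i : (i < m)%N -> (i < size (words n))%N by rewrite size_words.
pose A : 'M[K]_(m, size C) := \matrix_(i, j) nth (fun=> 0) C j (nth [::] (words n) i).
have rk : (2 <= \rank (kermx A))%N.
  by rewrite mxrank_ker; have := rank_leq_col A; lia.
pose B := row_base (kermx A).
pose vec (i : 'I_(\rank (kermx A))) : functional := fun w =>
  if insub (index w (words n)) is Some j then B i j else 0.
have vecE i (j : 'I_m) : vec i (nth [::] (words n) j) = B i j.
  rewrite /vec index_uniq ?uniq_words ?sW ?ltn_ord //.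
  by rewrite insubT // => ltj; congr (B _ _); apply: val_inj.
have BA : B *m A = 0.
  by apply/eqP; rewrite -sub_kermx eq_row_base submx_refl.
have /row_free_inj inj : row_free B by exact: row_base_free.
clearbody B.
have kill i c : c \in C -> pairing n c (vec i) = 0.
  move=> cC; pose j := Ordinal (etrans (index_mem c C) cC : (index c C < size C)%N).
  move/matrixP: BA => /(_ i j); rewrite !mxE => E; rewrite pairingE -[RHS]E.
  rewrite (big_nth [::]) size_words big_mkord; apply: eq_bigr => k _.
  by rewrite vecE !mxE /= nth_index // mulrC.
pose i0 : 'I_(\rank (kermx A)) := Ordinal (leq_trans (isT : (0 < 2)%N) rk).
pose i1 : 'I_(\rank (kermx A)) := Ordinal (leq_trans (isT : (1 < 2)%N) rk).
exists (vec i0), (vec i1); split; [exact: kill|exact: kill|].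
move=> a b H; pose v : 'rV[K]_(\rank (kermx A)) := a *: delta_mx 0 i0 + b *: delta_mx 0 i1.
have : v *m B = 0.
  apply/rowP => j; rewrite mulmxDl -!scalemxAl -!rowE !mxE.
  by rewrite -(vecE i0) -(vecE i1) H //; apply/eqP; rewrite -mem_words mem_nth ?sW.
rewrite -(mul0mx _ B) => /inj /rowP v0; split.
  by have := v0 i0; rewrite !mxE !eqxx /= mulr1 mulr0 addr0.
by have := v0 i1; rewrite !mxE !eqxx /= mulr1 mulr0 add0r.
Qed.

End Functionals.

(** * The periodic pattern *)

Section Cuts.
Context {K : fieldType}.
Notation functional := (word -> K).
Implicit Types (f g : functional) (L : seq functional) (n l : nat).

Lemma suffixes_last n1 n2 l L f g : (l <= n2)%N -> suffixes_in n2 l L g ->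
  suffixes_in (n1 + n2) l L (tens n1 f g).
Proof.
move=> ln2 sg x sx.
have n1x : (n1 <= size x)%N by lia.
apply: (span_ext (f := fun u => f (take n1 x) * g (drop n1 x ++ u))).
  by apply: span_scale; apply: sg; rewrite size_drop; lia.
move=> u _; rewrite /tens take_cat drop_cat ltn_neqAle n1x andbT.
case: eqVneq => //= ->.
by rewrite subnn take0 drop0 cats0 take_size drop_size.
Qed.

Lemma prefixes_first n1 n2 l L f g : (l <= n1)%N -> prefixes_in n1 l L f ->
  prefixes_in (n1 + n2) l L (tens n1 f g).
Proof.
move=> ln1 pf y sy.
apply: (span_ext (f := fun u => f (u ++ take (n1 - l) y) * g (drop (n1 - l) y))).
  by apply: span_scaler; apply: pf; rewrite size_takel; lia.
move=> u su; rewrite tens_catr su /tens.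
by rewrite take_oversize ?su // drop_oversize ?su.
Qed.

Lemma tens0 f : tens 0 (fun=> 1) f = f.
Proof. by apply/funext => w; rewrite /tens drop0 mul1r. Qed.

Definition zero_word : functional := fun w => (all (pred1 ord0) w)%:R.

Lemma suffixes_zero_word n l : suffixes_in n l [:: zero_word] zero_word.
Proof.
move=> x _; apply: (span_ext (f := fun u => zero_word x * zero_word u)).
  by apply: span_scale; apply: span_mem; rewrite inE.
by move=> u _; rewrite /zero_word all_cat -natrM mulnb.
Qed.

Lemma prefixes_zero_word n l : prefixes_in n l [:: zero_word] zero_word.
Proof.
move=> y _; apply: (span_ext (f := fun u => zero_word u * zero_word y)).
  by apply: span_scaler; apply: span_mem; rewrite inE.
by move=> u _; rewrite /zero_word all_cat -natrM mulnb.
Qed.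

Lemma suffixes_deltas n l f : suffixes_in n l (deltas l) f.
Proof. by move=> x _; apply: span_deltas. Qed.

Lemma prefixes_deltas n l f : prefixes_in n l (deltas l) f.
Proof. by move=> x _; apply: span_deltas. Qed.

Lemma size_tens_list n L1 L2 :
  size (tens_list n L1 L2) = (size L1 * size L2)%N.
Proof. by rewrite size_allpairs. Qed.

Lemma size_deltas n : size (@deltas K n) = (2 ^ n)%N.
Proof. by rewrite size_map size_words. Qed.

End Cuts.

Lemma size_flatten_leq (A B : Type) (F : A -> seq B) m (s : seq A) :
  (forall x, (size (F x) <= m)%N) -> (size (flatten [seq F x | x <- s]) <= size s * m)%N.
Proof.
move=> Fm; elim: s => //= x s IH; rewrite size_cat mulSn.
exact: leq_add.
Qed.

(** * Choice of Q and q for given relators over cells *)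

Section Selection.
Context {K : fieldType} (u : nat).
Notation functional := (word -> K).
Implicit Types (Q q f g : functional) (RR : seq (nat * functional)).
Local Notation zw := (@zero_word K).

(* Period of the pattern, in units of u letters: Q on [0,4), q on [8,11), zero
   letters elsewhere. A window of length between 12u-1 and 14u contains a full Q
   and touches at most 3u letters of the neighbouring copies of q, or it contains
   a full q, no full Q, and touches Q in such a way that the two cuts of Q span
   at most 2^(2u) functionals. *)
Definition head_block Q : functional := tens (4 * u) Q zw.
Definition tail_block q : functional := tens (3 * u) q zw.
Definition double_period Q q q' : functional :=
  tens (8 * u) (head_block Q) (tens (8 * u) (tail_block q)
    (tens (8 * u) (head_block Q) (tail_block q'))).

(** Going left from Q one meets 5u zero letters, the 3u letters of q, and zero letters again. As q
    is still unknown, its cut is replaced by all words of that length. *)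
Definition left_of_Q l : seq functional :=
  tens_list (l - 5 * u)
    (tens_list (l - 5 * u - 3 * u) [:: zw] (deltas (minn (l - 5 * u) (3 * u))))
    [:: zw].

Definition right_of_Q l : seq functional :=
  tens_list (4 * u) [:: zw]
    (tens_list (3 * u) (deltas (minn (l - 4 * u) (3 * u))) [:: zw]).

Definition conditions_Q RR : seq functional :=
  flatten [seq flatten [seq [seq contract l (tR.1 - 4 * u - l) tR.2 f g
      | f <- left_of_Q l, g <- right_of_Q (tR.1 - 4 * u - l)]
    | l <- iota 0 (10 * u).+1] | tR <- RR].

(** A cut of length [s] is spanned by the [2 ^ s] words of that length, and also by the
    [2 ^ (4 * u - s)] specialisations of Q; the smaller family is taken. *)
Definition suffixes_Q Q s : seq functional :=
  if (s <= 2 * u)%N then deltas s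
  else [seq (fun w => Q (v ++ w)) | v <- words (4 * u - s)].

Definition prefixes_Q Q s : seq functional :=
  if (s <= 2 * u)%N then deltas s
  else [seq (fun w => Q (w ++ v)) | v <- words (4 * u - s)].

Definition left_of_q Q l : seq functional :=
  tens_list (l - 4 * u) (suffixes_Q Q (l - 4 * u)) [:: zw].

Definition right_of_q Q l : seq functional :=
  tens_list (5 * u) [:: zw] (prefixes_Q Q (l - 5 * u)).

Definition conditions_q Q RR : seq functional :=
  flatten [seq flatten [seq [seq contract l (tR.1 - 3 * u - l) tR.2 f g
      | f <- left_of_q Q l, g <- right_of_q Q (tR.1 - 3 * u - l)]
    | l <- iota 0 (8 * u)] | tR <- RR].

Lemma suffixes_in_Q Q s : suffixes_in (4 * u) s (suffixes_Q Q s) Q.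
Proof.
rewrite /suffixes_Q; case: ifP => _; first exact: suffixes_deltas.
move=> x sx; apply: span_mem; apply/mapP; exists x => //.
by rewrite mem_words; apply/eqP; lia.
Qed.

Lemma prefixes_in_Q Q s : prefixes_in (4 * u) s (prefixes_Q Q s) Q.
Proof.
rewrite /prefixes_Q; case: ifP => _; first exact: prefixes_deltas.
move=> x sx; apply: span_mem; apply/mapP; exists x => //.
by rewrite mem_words; apply/eqP; lia.
Qed.

Lemma mem_conditions_Q RR t R l f g : (t, R) \in RR -> (l <= 10 * u)%N ->
  f \in left_of_Q l -> g \in right_of_Q (t - 4 * u - l) ->
  contract l (t - 4 * u - l) R f g \in conditions_Q RR.
Proof.
move=> tR lu fl gr; apply/flattenP; eexists; first by apply: map_f; exact: tR.
apply/flattenP; exists [seq contract l (t - 4 * u - l) R f g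
      | f <- left_of_Q l, g <- right_of_Q (t - 4 * u - l)].
  by apply/mapP; exists l; rewrite // mem_iota ltnS.
by apply/allpairsP; exists (f, g).
Qed.

Lemma mem_conditions_q Q RR t R l f g : (t, R) \in RR -> (l < 8 * u)%N ->
  f \in left_of_q Q l -> g \in right_of_q Q (t - 3 * u - l) ->
  contract l (t - 3 * u - l) R f g \in conditions_q Q RR.
Proof.
move=> tR lu fl gr; apply/flattenP; eexists; first by apply: map_f; exact: tR.
apply/flattenP; exists [seq contract l (t - 3 * u - l) R f g
      | f <- left_of_q Q l, g <- right_of_q Q (t - 3 * u - l)].
  by apply/mapP; exists l; rewrite // mem_iota.
by apply/allpairsP; exists (f, g).
Qed.

(** If the window meets both neighbouring copies of q, the two cuts have together at most
    [14u - 4u - 9u = u] letters; if it meets one, at most 3u. *)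
Lemma size_conditions_Q RR :
  (forall t R, (t, R) \in RR -> (t <= 14 * u)%N) ->
  (size (conditions_Q RR) <= size RR * ((10 * u).+1 * 2 ^ (3 * u)))%N.
Proof.
move=> tRR.
(* [size_flatten_leq] asks for a bound at every index, so the hypothesis on [t] is built into the
   list. *)
have -> : conditions_Q RR = flatten [seq flatten [seq
    if (tR.1 <= 14 * u)%N then [seq contract l (tR.1 - 4 * u - l) tR.2 f g
      | f <- left_of_Q l, g <- right_of_Q (tR.1 - 4 * u - l)] else [::]
    | l <- iota 0 (10 * u).+1] | tR <- RR].
  congr flatten; apply/eq_in_map => -[t R] /tRR tu; congr flatten.
  by apply: eq_map => l; rewrite /= tu.
apply: size_flatten_leq => -[t R]; rewrite -[X in (_ <= X * _)%N](size_iota 0).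
apply: size_flatten_leq => l /=; case: ifP => // tu.
rewrite size_allpairs /left_of_Q /right_of_Q !size_tens_list !size_deltas /=.
by rewrite ?mul1n ?muln1 -expnD leq_exp2l //; lia.
Qed.

(** Two consecutive copies of Q are 12u letters apart, so a window cutting both sees at most
    [14u - 12u = 2u] letters of Q; a single cut costs at most [2 ^ (2 * u)] by the choice in
    [suffixes_Q] and [prefixes_Q]. *)
Lemma size_conditions_q Q RR :
  (forall t R, (t, R) \in RR -> (t <= 14 * u)%N) ->
  (size (conditions_q Q RR) <= size RR * ((8 * u) * 2 ^ (2 * u)))%N.
Proof.
move=> tRR.
have -> : conditions_q Q RR = flatten [seq flatten [seq
    if (tR.1 <= 14 * u)%N && (l < 8 * u)%N then [seq contract l (tR.1 - 3 * u - l) tR.2 f g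
      | f <- left_of_q Q l, g <- right_of_q Q (tR.1 - 3 * u - l)] else [::]
    | l <- iota 0 (8 * u)] | tR <- RR].
  congr flatten; apply/eq_in_map => -[t R] /tRR tu; congr flatten.
  by apply/eq_in_map => l; rewrite mem_iota /= tu => ->.
apply: size_flatten_leq => -[t R]; rewrite -[X in (_ <= X * _)%N](size_iota 0).
apply: size_flatten_leq => l /=; case: ifP => // /andP [tu lu].
rewrite size_allpairs /left_of_q /right_of_q !size_tens_list /=.
rewrite ?mul1n ?muln1 /suffixes_Q /prefixes_Q.
case: ifP => ?; case: ifP => ?; rewrite !(size_deltas, size_map, size_words);
  by rewrite -expnD leq_exp2l //; lia.
Qed.

Section Kill.
Variables (RR : seq (nat * functional)) (Q q q' : functional).
Hypotheses (kQ : forall c, c \in conditions_Q RR -> pairing (4 * u) c Q = 0)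
  (kq : forall c, c \in conditions_q Q RR -> pairing (3 * u) c q = 0)
  (kq' : forall c, c \in conditions_q Q RR -> pairing (3 * u) c q' = 0).
Variables (t : nat) (R : functional) (x y : word).
Hypotheses (tR : (t, R) \in RR) (t_lb : (12 * u <= t.+1)%N) (t_ub : (t <= 14 * u)%N)
  (u_gt0 : (0 < u)%N).
Hypothesis (sxy : (size x + t + size y = 32 * u)%N).
Local Notation G := (double_period Q q q').

Lemma kill_at_Q n1 A C l : (size x + l = n1)%N -> (l + 4 * u <= t)%N -> (l <= 10 * u)%N ->
  span l (left_of_Q l) (fun v => A (x ++ v)) ->
  prefixes_in (t + size y - (l + 4 * u)) (t - 4 * u - l) (right_of_Q (t - 4 * u - l)) C ->
  G = tens n1 A (tens (4 * u) Q C) -> pairing t R (fun z => G (x ++ z ++ y)) = 0.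
Proof.
move=> sx lt lu sA sC ->; set l' := (t - 4 * u - l)%N in sC *.
have tE : t = (l + (4 * u + l'))%N by rewrite /l'; lia.
rewrite tE; apply: (kill_window sx sA (sC y _)) => [|f g fl gr].
  by rewrite /l'; lia.
by apply: kQ; apply: mem_conditions_Q.
Qed.

Lemma kill_at_q n1 A C l p : (size x + l = n1)%N -> (l + 3 * u <= t)%N -> (l < 8 * u)%N ->
  span l (left_of_q Q l) (fun v => A (x ++ v)) ->
  prefixes_in (t + size y - (l + 3 * u)) (t - 3 * u - l) (right_of_q Q (t - 3 * u - l)) C ->
  p \in [:: q; q'] ->
  G = tens n1 A (tens (3 * u) p C) -> pairing t R (fun z => G (x ++ z ++ y)) = 0.
Proof.
move=> sx lt lu sA sC pq ->; set l' := (t - 3 * u - l)%N in sC *.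
have tE : t = (l + (3 * u + l'))%N by rewrite /l'; lia.
rewrite tE; apply: (kill_window sx sA (sC y _)) => [|f g fl gr].
  by rewrite /l'; lia.
move: pq; rewrite !inE => /orP [] /eqP ->; [apply: kq|apply: kq'];
  exact: mem_conditions_q.
Qed.

Lemma right_of_QP q0 h n l :
  prefixes_in (5 * u + n) (l - 7 * u) [:: zw] h ->
  prefixes_in (12 * u + n) l (right_of_Q l) (tens (4 * u) zw (tens (3 * u) q0 h)).
Proof.
move=> ph; rewrite (_ : (12 * u + n = 4 * u + (3 * u + (5 * u + n)))%N); last by lia.
apply: prefixes_tens => _ ->; first exact: prefixes_zero_word.
apply: prefixes_tens => k kE.
  by rewrite -kE; exact: prefixes_deltas.
by rewrite kE -subnDA -mulnDl.
Qed.

Lemma double_periodE : G = tens (4 * u) Q (tens (4 * u) zw (tens (3 * u) q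
  (tens (5 * u) zw (tens (4 * u) Q (tens (4 * u) zw (tens (3 * u) q' zw)))))).
Proof.
rewrite /double_period /head_block /tail_block.
rewrite (@tensA _ _ (4 * u) (4 * u)) ?(@tensA _ _ (3 * u) (5 * u)); try lia.
by rewrite ?(@tensA _ _ (4 * u) (4 * u)); try lia.
Qed.

Lemma kill_first_Q : size x = 0%N -> pairing t R (fun z => G (x ++ z ++ y)) = 0.
Proof.
move=> x0; have xE := size0nil x0.
set C := tens (4 * u) zw (tens (3 * u) q
  (tens (5 * u) zw (tens (4 * u) Q (tens (4 * u) zw (tens (3 * u) q' zw))))).
apply: (@kill_at_Q 0 (fun=> 1) C 0) => //; try lia.
- rewrite /left_of_Q !sub0n min0n.
  (* Nothing lies to the left of Q; this member of [left_of_Q 0] takes the value 1 on the empty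
     word. *)
  apply: (span_ext (@span_mem _ 0 _ (tens 0 (tens 0 zw (delta [::])) zw) _)).
    apply/allpairsP; exists (tens 0 zw (delta [::]), zw); split; rewrite ?inE //=.
    apply/allpairsP; exists (zw, delta [::]); split; rewrite ?inE //=.
    by apply: map_f; rewrite mem_words.
  by move=> w /size0nil ->; rewrite /tens /zero_word /delta /= !mulr1.
- rewrite (_ : (t + size y - (0 + 4 * u) = 12 * u + 16 * u)%N); last by lia.
  apply: right_of_QP; apply: prefixes_first; first by lia.
  exact: prefixes_zero_word.
by rewrite double_periodE tens0.
Qed.

Lemma kill_second_Q : (size x <= 16 * u)%N -> (20 * u <= size x + t)%N ->
  pairing t R (fun z => G (x ++ z ++ y)) = 0.
Proof.
move=> xu xt; set l := (16 * u - size x)%N.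
pose A := tens (11 * u) (tens (8 * u) (head_block Q) q) zw.
apply: (@kill_at_Q (16 * u) A (tens (4 * u) zw (tens (3 * u) q' zw)) l); rewrite /l; try lia.
- suff S : suffixes_in (16 * u) l (left_of_Q l) A by apply: S; rewrite /l; lia.
  rewrite (_ : (16 * u = 11 * u + 5 * u)%N); last by lia.
  apply: suffixes_tens => _ ->; last exact: suffixes_zero_word.
  rewrite (_ : (11 * u = 8 * u + 3 * u)%N); last by lia.
  apply: suffixes_tens => k ->; last by exact: suffixes_deltas.
  rewrite (_ : (8 * u = 4 * u + 4 * u)%N); last by lia.
  apply: suffixes_last; first by rewrite /l; lia.
  exact: suffixes_zero_word.
- rewrite (_ : (_ - _ = 12 * u + 0)%N); last by lia.
  apply: right_of_QP; exact: prefixes_zero_word.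
rewrite double_periodE /A /head_block.
rewrite !(@tensA _ (16 * u) (11 * u) (5 * u)); try lia.
rewrite !(@tensA _ (11 * u) (8 * u) (3 * u)); try lia.
by rewrite !(@tensA _ (8 * u) (4 * u) (4 * u)); try lia.
Qed.

Lemma left_of_qP l : (l < 8 * u)%N -> suffixes_in (8 * u) l (left_of_q Q l) (head_block Q).
Proof.
move=> lu; rewrite (_ : (8 * u = 4 * u + 4 * u)%N); last by lia.
by apply: suffixes_tens => _ ->; [exact: suffixes_in_Q|exact: suffixes_zero_word].
Qed.

Lemma kill_first_q : (0 < size x <= 8 * u)%N -> (size x + t < 20 * u)%N ->
  pairing t R (fun z => G (x ++ z ++ y)) = 0.
Proof.
move=> xu xt; set l := (8 * u - size x)%N.
pose D := tens (4 * u) zw (tens (3 * u) q' zw).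
apply: (@kill_at_q (8 * u) (head_block Q) (tens (5 * u) zw (tens (4 * u) Q D)) l q);
  rewrite ?inE ?eqxx // /l; try lia.
- by apply: left_of_qP; lia.
- rewrite (_ : (_ - _ = 5 * u + (4 * u + 12 * u))%N); last by lia.
  apply: prefixes_tens => _ ->; first exact: prefixes_zero_word.
  by apply: prefixes_first; [lia|exact: prefixes_in_Q].
by rewrite double_periodE /head_block (@tensA _ (8 * u) (4 * u) (4 * u)); try lia.
Qed.

Lemma kill_second_q : (16 * u < size x)%N -> pairing t R (fun z => G (x ++ z ++ y)) = 0.
Proof.
move=> xu; set l := (24 * u - size x)%N.
pose A := tens (16 * u) (tens (8 * u) (head_block Q) (tail_block q)) (head_block Q).
apply: (@kill_at_q (24 * u) A zw l q'); rewrite ?inE ?eqxx ?orbT // /l; try lia.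
- suff S : suffixes_in (24 * u) l (left_of_q Q l) A by apply: S; rewrite /l; lia.
  rewrite (_ : (24 * u = 16 * u + 8 * u)%N); last by lia.
  by apply: suffixes_last; [rewrite /l; lia|apply: left_of_qP; rewrite /l; lia].
- rewrite (_ : (_ - _ = 5 * u + 0)%N); last by lia.
  (* No Q follows the last q: the zero letters are split to fit [right_of_q] with an empty cut of
     Q. *)
  rewrite (_ : zw = tens (5 * u) zw zw) /right_of_q; last first.
    apply/funext => w; rewrite /tens /zero_word -{1}(cat_take_drop (5 * u) w).
    by rewrite all_cat -natrM mulnb.
  apply: prefixes_tens => _ ->; first exact: prefixes_zero_word.
  rewrite (_ : (_ - _ = 0)%N); last by lia.
  by rewrite /prefixes_Q; apply: prefixes_deltas.
rewrite /A /double_period.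
rewrite !(@tensA _ (24 * u) (16 * u) (8 * u)); try lia.
by rewrite !(@tensA _ (16 * u) (8 * u) (8 * u)); try lia.
Qed.

(** A window without a full Q starts after position 16u, or strictly after 0 and ends before 20u. In
    the latter case [12u - 1 <= t] gives [size x <= 8u], which is exactly where q begins, so the
    letter missing from 12u does no harm. *)
Lemma kill_double_period : pairing t R (fun z => G (x ++ z ++ y)) = 0.
Proof.
have [x0|x0] := posnP (size x); first exact: kill_first_Q.
have [xu|xu] := ltnP (16 * u) (size x); first exact: kill_second_q.
have [xt|xt] := ltnP (size x + t) (20 * u); last exact: kill_second_Q.
by apply: kill_first_q; lia.
Qed.

End Kill.

(** Both systems have a margin of [u] letters: 4u against cuts of 3u for Q, 3u against cuts of 2u
    for q. The factor 16u exceeds the number of window positions, and the strict inequality leaves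
    room for the two solutions. *)
Lemma selection RR : (0 < u)%N ->
  (forall t R, (t, R) \in RR -> (12 * u <= t.+1)%N /\ (t <= 14 * u)%N) ->
  (size RR * (16 * u) < 2 ^ u)%N ->
  exists a b1 b2 : functional,
    [/\ exists w, size w = (8 * u)%N /\ a w != 0,
        forall c1 c2, (forall w, size w = (8 * u)%N -> c1 * b1 w + c2 * b2 w = 0) ->
          c1 = 0 /\ c2 = 0 &
        forall t R b b' x y, (t, R) \in RR -> b \in [:: b1; b2] -> b' \in [:: b1; b2] ->
          (size x + t + size y = 32 * u)%N ->
          pairing t R (fun z => tens (8 * u) a (tens (8 * u) b
            (tens (8 * u) a b')) (x ++ z ++ y)) = 0].
Proof.
move=> u_gt0 tRR sRR.
have pu n : (0 < 2 ^ n)%N by rewrite expn_gt0.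
have tRR' t R : (t, R) \in RR -> (t <= 14 * u)%N by case/tRR.
have exp_le m n : (m <= n)%N -> (2 ^ m <= 2 ^ n)%N by move=> mn; rewrite leq_exp2l.
have [|Q [Q' [kQ _ Qfree]]] := @two_annihilated K (4 * u) (conditions_Q RR).
  have := size_conditions_Q tRR'; have := exp_le 1%N (3 * u)%N.
  by rewrite (_ : (4 * u = u + 3 * u)%N) ?expnD; [nia|lia].
have [|q1 [q2 [kq1 kq2 qfree]]] := @two_annihilated K (3 * u) (conditions_q Q RR).
  have := size_conditions_q Q tRR'; have := exp_le 1%N (2 * u)%N.
  by rewrite (_ : (3 * u = u + 2 * u)%N) ?expnD; [nia|lia].
have zw0 n : zw (nseq n ord0) = 1 by rewrite /zero_word all_nseq /= eqxx orbT.
have [w [sw Qw]] : exists w, size w = (4 * u)%N /\ Q w != 0.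
  apply: contrapT => H; have [|/eqP] := Qfree 1 0; last by rewrite oner_eq0.
  move=> w sw; rewrite mul0r addr0 mul1r; apply: contrapT => /eqP Qw; apply: H.
  by exists w.
exists (head_block Q), (tail_block q1), (tail_block q2); split.
- exists (w ++ nseq (4 * u) ord0); rewrite size_cat size_nseq sw; split; first by lia.
  by rewrite /head_block /tens take_size_cat // drop_size_cat // zw0 mulr1.
- move=> c1 c2 H; apply: qfree => v sv.
  have := H (v ++ nseq (5 * u) ord0); rewrite size_cat size_nseq sv.
  rewrite /tail_block /tens take_size_cat // drop_size_cat // zw0 !mulr1.
  by apply; lia.
move=> t R b b' x y tR bm b'm sxy.
have [lb ub] := tRR _ _ tR.
have tb c : c \in [:: tail_block q1; tail_block q2] -> exists2 q,
    c = tail_block q & forall d, d \in conditions_q Q RR -> pairing (3 * u) d q = 0.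
  by rewrite !inE => /orP [] /eqP ->; [exists q1|exists q2].
have [q -> kq] := tb _ bm; have [q' -> kq'] := tb _ b'm.
exact: (kill_double_period kQ kq kq' tR lb ub u_gt0 sxy).
Qed.

End Selection.

(** * Chains of functionals *)

Section Chains.
Context {K : fieldType}.
Notation functional := (word -> K).
Implicit Types (f g h : functional) (L M : seq functional) (l m n s : nat).

Lemma suffixes_span n l L M f : span n L f ->
  (forall g, g \in L -> suffixes_in n l M g) -> suffixes_in n l M f.
Proof.
move=> sf H x sx.
apply: (span_ext (@span_map _ n l L M (fun u => x ++ u) (fun=> 1) f _ _ sf)).
- by move=> u su; rewrite size_cat su.
- by move=> g gL; apply: (span_ext (H g gL x sx)) => u _; rewrite mul1r.
by move=> u _; rewrite mul1r.
Qed.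

Lemma prefixes_span n l L M f : span n L f ->
  (forall g, g \in L -> prefixes_in n l M g) -> prefixes_in n l M f.
Proof.
move=> sf H y sy.
apply: (span_ext (@span_map _ n l L M (fun u => u ++ y) (fun=> 1) f _ _ sf)).
- by move=> u su; rewrite size_cat su.
- by move=> g gL; apply: (span_ext (H g gL y sy)) => u _; rewrite mul1r.
by move=> u _; rewrite mul1r.
Qed.

Definition window_in n i l L f := forall x y, size x = i ->
  (size x + l + size y)%N = n -> span l L (fun u => f (x ++ u ++ y)).

Lemma window_span n i l L M f : span n L f ->
  (forall g, g \in L -> window_in n i l M g) -> window_in n i l M f.
Proof.
move=> sf H x y xi sxy.
apply: (span_ext (@span_map _ n l L M (fun u => x ++ u ++ y) (fun=> 1) f _ _ sf)).
- by move=> u su; rewrite !size_cat su addnA.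
- by move=> g gL; apply: (span_ext (H g gL x y xi sxy)) => u _; rewrite mul1r.
by move=> u _; rewrite mul1r.
Qed.

Lemma pairing_window_span n l r x y L f : span n L f ->
  (size x + l + size y)%N = n ->
  (forall g, g \in L -> pairing l r (fun u => g (x ++ u ++ y)) = 0) ->
  pairing l r (fun u => f (x ++ u ++ y)) = 0.
Proof.
move=> sf sxy H.
have sz u : size u = l -> size (x ++ u ++ y) = n by rewrite !size_cat => ->; rewrite addnA.
elim: sf => {f} [f f0|a g h f gL _ IH E].
  rewrite (pairing_ext (g := fun=> 0) r) => [|u /sz /f0 //].
  by rewrite /pairing big1 // => u _; rewrite mulr0.
rewrite (pairing_ext (g := fun u => a * g (x ++ u ++ y) + h (x ++ u ++ y)) r) => [|u /sz /E //].
by rewrite pairing_lin H // IH mulr0 addr0.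
Qed.

Lemma pairing_scale l r a f : pairing l r (fun u => a * f u) = a * pairing l r f.
Proof. by rewrite /pairing big_distrr; apply: eq_bigr => u _; rewrite mulrCA. Qed.

Lemma tens_left n f g x u y : (size x + size u <= n)%N ->
  tens n f g (x ++ u ++ y) =
  g (drop (n - size x - size u) y) * f (x ++ u ++ take (n - size x - size u) y).
Proof.
move=> le; rewrite /tens mulrC catA take_cat drop_cat size_cat.
rewrite subnDA; case: ltnP => [lt|_]; first by lia.
by rewrite -catA.
Qed.

Lemma tens_right n f g x u y : (n <= size x)%N ->
  tens n f g (x ++ u ++ y) = f (take n x) * g (drop n x ++ u ++ y).
Proof.
move=> le; rewrite /tens take_cat drop_cat ltn_neqAle le andbT.
case: eqVneq => //= ->.
by rewrite subnn take0 drop0 cats0 take_size drop_size.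
Qed.

Lemma tens_straddle n f g x u y : (size x <= n)%N -> (n <= size x + size u)%N ->
  tens n f g (x ++ u ++ y) =
  tens (n - size x) (fun v => f (x ++ v)) (fun v => g (v ++ y)) u.
Proof.
move=> xn nu; rewrite tens_catl tens_catr.
have -> : (n - size x - size u = 0)%N by lia.
by rewrite /tens take_oversize // drop_oversize //= take0 drop0 cats0.
Qed.

Lemma span_nil L f : (fun=> 1) \in L -> span 0 L f.
Proof.
move=> L1; apply: (span_ext (span_scale (f [::]) (@span_mem _ 0 _ _ L1))).
by move=> u /size0nil ->; rewrite mulr1.
Qed.

Variable P : nat -> seq functional.

Definition chained :=
  forall s f, f \in P s.+1 -> span (2 ^ s.+1) (tens_list (2 ^ s) (P s) (P s)) f.

(** Complete right halves are peeled off. The product involves each [P i] at most once, besides one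
    additional [P 0]; this is the summand 1 in [total_exponent]. *)
Fixpoint suffixes m l : seq functional :=
  if m is m'.+1 then
    if (l <= 2 ^ m')%N then suffixes m' l
    else tens_list (l - 2 ^ m') (suffixes m' (l - 2 ^ m')) (P m')
  else if l is 0 then [:: fun=> 1] else P 0.

Fixpoint prefixes m l : seq functional :=
  if m is m'.+1 then
    if (l <= 2 ^ m')%N then prefixes m' l
    else tens_list (2 ^ m') (P m') (prefixes m' (l - 2 ^ m'))
  else if l is 0 then [:: fun=> 1] else P 0.

Lemma suffixes0 m : suffixes m 0 = [:: fun=> 1].
Proof. by elim: m. Qed.

Lemma prefixes0 m : prefixes m 0 = [:: fun=> 1].
Proof. by elim: m. Qed.

Lemma suffixes_widen m m' l : (l <= 2 ^ m)%N -> (m <= m')%N ->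
  suffixes m' l = suffixes m l.
Proof.
move=> lm /subnK <-; elim: (m' - m)%N => //= k ->.
by rewrite (leq_trans lm) // leq_exp2l // leq_addl.
Qed.

Lemma prefixes_widen m m' l : (l <= 2 ^ m)%N -> (m <= m')%N ->
  prefixes m' l = prefixes m l.
Proof.
move=> lm /subnK <-; elim: (m' - m)%N => //= k ->.
by rewrite (leq_trans lm) // leq_exp2l // leq_addl.
Qed.

Lemma suffixes_eq m m' l : (l <= 2 ^ m)%N -> (l <= 2 ^ m')%N ->
  suffixes m' l = suffixes m l.
Proof.
by case: (leqP m m') => [/suffixes_widen H /H|/ltnW /suffixes_widen H _ /H ->].
Qed.

Lemma prefixes_eq m m' l : (l <= 2 ^ m)%N -> (l <= 2 ^ m')%N ->
  prefixes m' l = prefixes m l.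
Proof.
by case: (leqP m m') => [/prefixes_widen H /H|/ltnW /prefixes_widen H _ /H ->].
Qed.

Hypothesis chP : chained.

Lemma suffixesP m l f : f \in P m -> suffixes_in (2 ^ m) l (suffixes m l) f.
Proof.
elim: m l f => [|m IH] l f fP.
  case: l => [|l] x sx; first by apply: span_nil; rewrite inE.
  have -> : x = [::] by apply: size0nil; rewrite expn0 in sx; lia.
  by rewrite /=; apply: span_mem.
apply: (suffixes_span (chP fP)) => _ /allpairsP [[g h] /= [gP hP ->]].
rewrite expnS mul2n -addnn.
case: leqP => lm; first by apply: suffixes_last => //; apply: IH.
apply: suffixes_tens => _ ->; first exact: IH.
rewrite (minn_idPr (ltnW lm)) => x sx; have -> : x = [::] by apply: size0nil; lia.
exact: span_mem.
Qed.

Lemma prefixesP m l f : f \in P m -> prefixes_in (2 ^ m) l (prefixes m l) f.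
Proof.
elim: m l f => [|m IH] l f fP.
  case: l => [|l] x sx; first by apply: span_nil; rewrite inE.
  have -> : x = [::] by apply: size0nil; rewrite expn0 in sx; lia.
  by apply: (span_ext (span_mem _ fP)) => u _; rewrite cats0.
apply: (prefixes_span (chP fP)) => _ /allpairsP [[g h] /= [gP hP ->]].
rewrite expnS mul2n -addnn.
case: leqP => lm; first by apply: prefixes_first => //; apply: IH.
apply: prefixes_tens => _ ->; last exact: IH.
rewrite (minn_idPr (ltnW lm)) => x sx; have -> : x = [::] by apply: size0nil; lia.
by apply: (span_ext (span_mem _ gP)) => u _; rewrite cats0.
Qed.

Lemma suffix_block m s f : (m <= s)%N -> f \in P s -> suffixes_in (2 ^ s) (2 ^ m) (P m) f.
Proof.
move=> /subnK <-; elim: (s - m)%N f => [|k IH] f fP.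
  by rewrite add0n => x sx; have -> : x = [::] by [apply: size0nil; lia]; apply: span_mem.
apply: (suffixes_span (chP fP)) => _ /allpairsP [[g h] /= [gP hP ->]].
rewrite expnS mul2n -addnn; apply: suffixes_last; last exact: IH.
by rewrite leq_exp2l // leq_addl.
Qed.

Lemma prefix_block m s f : (m <= s)%N -> f \in P s -> prefixes_in (2 ^ s) (2 ^ m) (P m) f.
Proof.
move=> /subnK <-; elim: (s - m)%N f => [|k IH] f fP.
  rewrite add0n => x sx; have -> : x = [::] by apply: size0nil; lia.
  by apply: (span_ext (span_mem _ fP)) => u _; rewrite cats0.
apply: (prefixes_span (chP fP)) => _ /allpairsP [[g h] /= [gP hP ->]].
rewrite expnS mul2n -addnn; apply: prefixes_first; last exact: IH.
by rewrite leq_exp2l // leq_addl.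
Qed.

(** Halving the block, one reaches a block whose middle the window straddles, and cuts there. The
    cut [l1] depends on the position alone, so one list serves all of [P s], and its size depends on
    [m] but not on [s]. *)
Lemma windows_bounded m s i l : (l <= 2 ^ m)%N -> (i + l <= 2 ^ s)%N ->
  exists2 l1, (l1 <= l)%N & forall f, f \in P s ->
    window_in (2 ^ s) i l (tens_list l1 (suffixes m l1) (prefixes m (l - l1))) f.
Proof.
move=> lm; elim: s i => [|s IH] i il.
  rewrite expn0 in il *; case: l lm il => [|l] lm il.
    exists 0%N => // f fP x y _ _; rewrite suffixes0 prefixes0.
    apply: span_nil; apply/allpairsP; exists (fun=> 1, fun=> 1); rewrite !inE.
    by split=> //; apply/funext => w; rewrite /tens mulr1.
  exists 1%N; first by [].
  have l0 : l = 0%N by lia.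
  move=> f fP x y _ sxy; rewrite l0 subnn prefixes0.
  have -> : x = [::] by apply: size0nil; lia.
  have -> : y = [::] by apply: size0nil; lia.
  apply: (span_ext (f := tens 1 f (fun=> 1))); last first.
    by move=> u su; rewrite /tens take_oversize ?su // mulr1 cats0.
  apply: span_tens; last by apply: span_mem; rewrite inE.
  by rewrite minnn (@suffixes_eq 0) ?expn_gt0 //; apply: span_mem.
have E : (2 ^ s.+1 = 2 ^ s + 2 ^ s)%N by rewrite expnS mul2n addnn.
have [ils|ils] := leqP (i + l) (2 ^ s).
  have [l1 l1l H] := IH i ils; exists l1 => // f fP.
  apply: (window_span (chP fP)) => _ /allpairsP [[g h] /= [gP hP ->]] x y xi sxy.
  apply: (span_ext (span_scale (h (drop (2 ^ s - size x - l) y))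
    (H g gP x (take (2 ^ s - size x - l) y) xi _))); first by rewrite size_takel; lia.
  by move=> u su; rewrite tens_left su //; lia.
have [si|si] := leqP (2 ^ s) i.
  have [|l1 l1l H] := IH (i - 2 ^ s)%N; first by lia.
  exists l1 => // f fP.
  apply: (window_span (chP fP)) => _ /allpairsP [[g h] /= [gP hP ->]] x y xi sxy.
  apply: (span_ext (span_scale (g (take (2 ^ s) x)) (H h hP (drop (2 ^ s) x) y _ _))).
  - by rewrite size_drop xi.
  - by rewrite size_drop; lia.
  by move=> u _; rewrite tens_right ?xi.
exists (2 ^ s - i)%N; first by lia.
move=> f fP; apply: (window_span (chP fP)) => _ /allpairsP [[g h] /= [gP hP ->]] x y xi sxy.
apply: (span_ext (f := tens (2 ^ s - i) (fun v => g (x ++ v)) (fun v => h (v ++ y)))).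
  apply: span_tens.
    rewrite (minn_idPr _); last by lia.
    rewrite (@suffixes_eq s); [|by lia|by lia].
    by apply: suffixesP => //; lia.
  rewrite (@prefixes_eq s); [|by lia|by lia].
  by apply: prefixesP => //; lia.
by move=> u su; rewrite tens_straddle xi ?su //; lia.
Qed.

(** A window across the middle of a higher block sees only the last [2 ^ m] letters of one half and
    the first [2 ^ m] of the other. Both pieces lie in the span of [P m], so two adjacent blocks of
    level [m] already show every case. *)
Lemma kill_propagates m l r : (l <= 2 ^ m)%N ->
  (forall g h x y, g \in P m -> h \in P m -> (size x + l + size y = 2 ^ m.+1)%N ->
    pairing l r (fun z => tens (2 ^ m) g h (x ++ z ++ y)) = 0) ->
  forall s f x y, (m < s)%N -> f \in P s -> (size x + l + size y = 2 ^ s)%N ->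
    pairing l r (fun z => f (x ++ z ++ y)) = 0.
Proof.
move=> lm H s f x y /subnK <-; elim: (s - m.+1)%N f x y => [|k IH] f x y fP sxy.
  apply: (pairing_window_span (chP fP) sxy) => _ /allpairsP [[g h] /= [gP hP ->]].
  exact: H.
rewrite addSn in fP sxy; move: IH fP sxy; set s' := (k + m.+1)%N => IH fP sxy.
have E : (2 ^ s'.+1 = 2 ^ s' + 2 ^ s')%N by rewrite expnS mul2n addnn.
apply: (pairing_window_span (chP fP) sxy) => _ /allpairsP [[g h] /= [gP hP ->]].
have [ils|ils] := leqP (size x + l) (2 ^ s').
  rewrite (pairing_ext r (g := fun u => h (drop (2 ^ s' - size x - l) y) *
     g (x ++ u ++ take (2 ^ s' - size x - l) y))).
    by rewrite pairing_scale IH ?mulr0 // size_takel; lia.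
  by move=> u su; rewrite tens_left su //; lia.
have [si|si] := leqP (2 ^ s') (size x).
  rewrite (pairing_ext r (g := fun u => g (take (2 ^ s') x) * h (drop (2 ^ s') x ++ u ++ y))).
    by rewrite pairing_scale IH ?mulr0 // size_drop; lia.
  by move=> u _; rewrite tens_right.
have ms : (m <= s')%N by rewrite /s'; lia.
have ps : (2 ^ m <= 2 ^ s')%N by rewrite leq_exp2l.
(* [take i x] precedes the two blocks of length [2 ^ m] around the middle; [j] letters of [y]
   complete the right one. *)
set i := (2 ^ s' - 2 ^ m)%N; set j := (2 ^ m - (l - (2 ^ s' - size x)))%N.
pose W := tens (2 ^ m) (fun v => g (take i x ++ v)) (fun v => h (v ++ drop j y)).
have sW : span (2 ^ m.+1) (tens_list (2 ^ m) (P m) (P m)) W.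
  have E' : (2 ^ m.+1 = 2 ^ m + 2 ^ m)%N by rewrite expnS mul2n addnn.
  apply: span_tens.
    rewrite (minn_idPr _); last by lia.
    by apply: suffix_block ms gP _ _; rewrite size_takel /i; lia.
  have -> : (2 ^ m.+1 - 2 ^ m = 2 ^ m)%N by lia.
  by apply: prefix_block ms hP _ _; rewrite size_drop /j; lia.
rewrite (pairing_ext r (g := fun u => W (drop i x ++ u ++ take j y))).
  apply: (pairing_window_span sW); first by rewrite size_drop size_take_min expnS /i /j; lia.
  move=> _ /allpairsP [[g' h'] /= [gP' hP' ->]]; apply: H => //.
  by rewrite size_drop size_take_min expnS /i /j; lia.
move=> u su; rewrite tens_straddle ?su; [|by lia|by lia].
rewrite /W tens_straddle ?su ?size_drop; [|by rewrite /i; lia|by rewrite /i; lia].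
have -> : (2 ^ m - (size x - i) = 2 ^ s' - size x)%N by rewrite /i; lia.
by rewrite /tens !catA cat_take_drop -[in RHS](catA _ (take j y)) cat_take_drop.
Qed.

End Chains.

(** * Words over cells *)

Section Lifting.
Context {K : fieldType} (c : nat) (gam : 'I_2 -> word -> K).
Notation functional := (word -> K).
Implicit Types (f g h G : functional) (L M : seq functional) (l m n s t : nat).

(* The alphabet 'I_2 doubles as an alphabet of cells: the functional gam i, for
   words of length c, is the letter i. *)
Fixpoint eval (w : word) : functional :=
  if w is i :: w' then tens c (gam i) (eval w') else fun=> 1.

Lemma eval_cat w1 w2 : eval (w1 ++ w2) = tens (c * size w1) (eval w1) (eval w2).
Proof.
elim: w1 => [|i w1 IH] /=; first by rewrite muln0 tens0.
by rewrite IH (@tensA _ _ c (c * size w1)) // mulnS.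
Qed.

(** The [t]-th tensor power of the linear map sending the letter [i] to [gam i]. *)
Definition inflate t G : functional := fun X => \sum_(w <- words t) G w * eval w X.

Lemma inflate_tens t1 t2 G H X :
  inflate (t1 + t2) (tens t1 G H) X = tens (c * t1) (inflate t1 G) (inflate t2 H) X.
Proof.
rewrite /inflate big_words_cat [RHS]/tens big_distrl /= big_seq [RHS]big_seq.
apply: eq_bigr => w1; rewrite mem_words => /eqP s1; rewrite big_distrr /=.
apply: eq_bigr => w2 _; rewrite eval_cat /tens s1 take_size_cat // drop_size_cat //.
by rewrite -!mulrA; congr (_ * _); rewrite mulrCA.
Qed.

Lemma words1 (F : word -> K) : \sum_(w <- words 1) F w = F [:: ord0] + F [:: ord_max].
Proof.
transitivity (\sum_(w <- [:: [:: ord0]; [:: ord_max : 'I_2]]) F w); last first.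
  by rewrite big_cons big_seq1.
apply: perm_big; apply: uniq_perm; rewrite ?uniq_words // => w.
rewrite mem_words !inE; case: w => [|i [|? ?]] //=; rewrite ?eqseq_cons ?andbT ?andbF //.
by case: i => -[|[|]].
Qed.

(** A tensor power of an injective map is injective: for a fixed tail [X], independence of the two
    cells separates the halves of [G] by first letter. *)
Lemma inflate_free t G :
  (forall a b, (forall u, size u = c -> a * gam ord0 u + b * gam ord_max u = 0) ->
     a = 0 /\ b = 0) ->
  (forall X, size X = (c * t)%N -> inflate t G X = 0) ->
  forall w, size w = t -> G w = 0.
Proof.
move=> fr; elim: t G => [|t IH] G H w sw.
  have := H [::]; rewrite muln0 => /(_ erefl); rewrite (size0nil sw) /inflate.
  rewrite (big_rem [::]) ?mem_words //= mulr1.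
  rewrite big1_seq ?addr0 // => v /andP [_ /[dup]].
  move/mem_rem; rewrite mem_words => /eqP /size0nil ->.
  by rewrite mem_rem_uniq ?uniq_words // inE eqxx.
case: w sw => [//|i w] [sw].
have E X u : size u = c -> inflate t.+1 G (u ++ X) =
    gam ord0 u * inflate t (fun v => G (ord0 :: v)) X +
    gam ord_max u * inflate t (fun v => G (ord_max :: v)) X.
  move=> su; rewrite /inflate -[t.+1]add1n big_words_cat words1 !big_distrr /=.
  by congr (_ + _); apply: eq_bigr => v _; rewrite /tens take_size_cat // drop_size_cat // mulrCA.
have H' X : size X = (c * t)%N ->
    inflate t (fun v => G (ord0 :: v)) X = 0 /\ inflate t (fun v => G (ord_max :: v)) X = 0.
  move=> sX; apply: fr => u su; rewrite ![inflate _ _ _ * _]mulrC -E //.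
  by rewrite H // size_cat su sX mulnS.
have [->|->] : i = ord0 \/ i = ord_max.
  by case: i => -[|[|]] // ?; [left|right]; apply: val_inj.
- by apply: (IH (fun v => G (ord0 :: v))) => // X /H' [].
by apply: (IH (fun v => G (ord_max :: v))) => // X /H' [].
Qed.

Lemma eval_suffixes l L w : (l <= c)%N -> (l <= c * size w)%N ->
  (forall i, suffixes_in c l L (gam i)) -> (l = 0%N -> (fun=> 1) \in L) ->
  suffixes_in (c * size w) l L (eval w).
Proof.
move=> lc lw gL L1.
have [l0|l_gt0] := posnP l; first by move=> x _; rewrite l0; apply: span_nil; exact: L1.
case: w lw => [|i0 w0]; first by rewrite muln0; lia.
rewrite lastI; set w := belast _ _; set i := last _ _ => _.
rewrite -cats1 eval_cat size_cat mulnDr; apply: suffixes_last; first by rewrite muln1.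
move=> x sx; rewrite /= muln1 in sx.
by apply: (span_ext (gL i x sx)) => u su; rewrite /= /tens mulr1 take_oversize // size_cat su sx.
Qed.

Lemma eval_prefixes l L w : (l <= c)%N -> (l <= c * size w)%N ->
  (forall i, prefixes_in c l L (gam i)) -> (l = 0%N -> (fun=> 1) \in L) ->
  prefixes_in (c * size w) l L (eval w).
Proof.
move=> lc lw gL L1.
have [l0|l_gt0] := posnP l; first by move=> x _; rewrite l0; apply: span_nil; exact: L1.
case: w lw => [|i w]; first by rewrite muln0; lia.
move=> _; rewrite /= mulnS; apply: prefixes_first => //; exact: gL.
Qed.

Hypothesis c_gt0 : (0 < c)%N.
Variables (SL PL : nat -> seq functional).
Hypotheses (SLP : forall i l, suffixes_in c l (SL l) (gam i))
  (PLP : forall i l, prefixes_in c l (PL l) (gam i))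
  (SL0 : SL 0 = [:: fun=> 1]) (PL0 : PL 0 = [:: fun=> 1]).

(** Turns a relator over letters into one over cells: the window starts [l] letters before a cell
    border, and [f] and [g] absorb the incomplete cells at its ends. *)
Definition cell_contract k l f g r : nat * functional :=
  (((k - l) %/ c)%N, fun w =>
    pairing (c * ((k - l) %/ c)) (contract l ((k - l) %% c) r f g) (eval w)).

Definition cell_contracts (DD : seq (nat * functional)) : seq (nat * functional) :=
  flatten [seq flatten [seq [seq cell_contract kr.1 l f g kr.2
     | f <- SL l, g <- PL ((kr.1 - l) %% c)] | l <- iota 0 c] | kr <- DD].

Lemma size_cell_contracts DD p :
  (forall l, (l < c)%N -> (size (SL l) <= p)%N /\ (size (PL l) <= p)%N) ->
  (size (cell_contracts DD) <= size DD * (c * (p * p)))%N.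
Proof.
move=> sp.
have -> : cell_contracts DD = flatten [seq flatten [seq
    if (l < c)%N then [seq cell_contract kr.1 l f g kr.2
      | f <- SL l, g <- PL ((kr.1 - l) %% c)] else [::] | l <- iota 0 c] | kr <- DD].
  congr flatten; apply/eq_in_map => kr _; congr flatten.
  by apply/eq_in_map => l; rewrite mem_iota => /= ->.
apply: size_flatten_leq => kr; rewrite -[X in (_ <= X * _)%N](size_iota 0).
apply: size_flatten_leq => l; case: ifP => // lc; rewrite size_allpairs leq_mul //.
  by case: (sp l lc).
by case: (sp ((kr.1 - l) %% c)%N); rewrite ?ltn_mod.
Qed.

Lemma inflate_kill T G DD :
  (forall t R x y, (t, R) \in cell_contracts DD -> (size x + t + size y = T)%N ->
    pairing t R (fun z => G (x ++ z ++ y)) = 0) ->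
  forall k r x y, (k, r) \in DD -> (c <= k)%N -> (size x + k + size y = c * T)%N ->
    pairing k r (fun z => inflate T G (x ++ z ++ y)) = 0.
Proof.
move=> H k r x y kr ck sxy.
(* Distance from the start of the window to the next cell border; the outer remainder makes it 0 on
   a border. *)
pose l := ((c - size x %% c) %% c)%N.
have lc : (l < c)%N by rewrite ltn_mod.
have lk : (l <= k)%N by lia.
have /dvdnP [o oE] : (c %| size x + l)%N.
  rewrite /dvdn modnDmr -modnDml subnKC ?modnn //.
  by rewrite ltnW // ltn_mod.
pose t := ((k - l) %/ c)%N; pose l' := ((k - l) %% c)%N.
have kE : k = (l + (c * t + l'))%N by rewrite /t /l' mulnC -divn_eq subnKC.
have l'c : (l' < c)%N by rewrite ltn_mod.
have [o' o'E] : exists o', (l' + size y = o' * c)%N.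
  by exists (T - o - t)%N; rewrite !mulnBl; lia.
have TE : T = (o + (t + o'))%N.
  apply/eqP; rewrite -(eqn_pmul2l c_gt0); apply/eqP; lia.
(* Fixing the cells before and after the complete ones leaves one product to kill for each pair
   [w1], [w3]. *)
rewrite (pairing_ext (g := fun z => \sum_(w1 <- words o) \sum_(w3 <- words o')
   tens (c * o) (eval w1) (tens (c * t)
      (fun X => \sum_(w2 <- words t) G (w1 ++ w2 ++ w3) * eval w2 X) (eval w3))
      (x ++ z ++ y)) r); last first.
  move=> z sz; rewrite /inflate TE big_words_cat big_seq [RHS]big_seq.
  apply: eq_bigr => w1; rewrite mem_words => /eqP s1.
  rewrite big_words_cat exchange_big /=; apply: eq_bigr => w3 _.
  rewrite [in RHS]/tens big_distrl big_distrr /= big_seq [RHS]big_seq.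
  apply: eq_bigr => w2; rewrite mem_words => /eqP s2.
  by rewrite !eval_cat s1 s2 /tens -!mulrA [RHS]mulrCA.
have psum (I : eqType) (s : seq I) (F : I -> functional) :
    (forall i, i \in s -> pairing k r (F i) = 0) ->
    pairing k r (fun z => \sum_(i <- s) F i z) = 0.
  move=> F0; rewrite /pairing.
  under eq_bigr do rewrite big_distrr /=.
  by rewrite exchange_big /= big1_seq // => i /andP [_ /F0].
apply: (psum) => w1; rewrite mem_words => /eqP s1.
apply: (psum) => w3; rewrite mem_words => /eqP s3.
rewrite {1}kE; apply: (@kill_window _ _ _ _ _ _ _ _ _ _ _ (SL l) (PL l')).
- by rewrite oE mulnC.
- have := @eval_suffixes l (SL l) w1 (ltnW lc); rewrite s1; apply; last by rewrite mulnC.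
  + by rewrite mulnC -oE leq_addl.
  + by move=> i; exact: SLP.
  by move=> ->; rewrite SL0 inE.
- have := @eval_prefixes l' (PL l') w3 (ltnW l'c); rewrite s3; apply; last by rewrite mulnC.
  + by rewrite mulnC -o'E leq_addr.
  + by move=> i; exact: PLP.
  by move=> ->; rewrite PL0 inE.
move=> f g fS gP.
have tR : cell_contract k l f g r \in cell_contracts DD.
  apply/flattenP; eexists; first by apply: map_f; exact: kr.
  apply/flattenP; exists [seq cell_contract k l f g r | f <- SL l, g <- PL l'].
    by apply/mapP; exists l; rewrite // mem_iota.
  by apply/allpairsP; exists (f, g).
have := H _ _ w1 w3 tR; rewrite s1 s3 -/t -addnA -TE => /(_ erefl) E.
rewrite -[RHS]E [RHS]pairingE /pairing.
under eq_bigr do rewrite big_distrr /=.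
rewrite exchange_big /=; apply: eq_bigr => w2 _.
rewrite big_distrl /=; apply: eq_bigr => X _.
by rewrite mulrCA mulrC.
Qed.

End Lifting.

(** * The schedule of levels *)

Section Schedule.
Variables (d : nat) (act : pred nat).
Implicit Types (m n s : nat).
Hypotheses (d_ge50 : (50 <= d)%N)
  (act_large : forall n, act n -> (0 < n)%N /\ (72 * (d * n) <= 7 * 2 ^ n)%N)
  (act_sparse : forall m n, act m -> act n -> (m < n)%N -> (1000 * m <= n)%N).

(* The least l such that 7 * 2 ^ l >= 9 d n; 2 ^ l is the parameter u of the
   selection lemma at level n. *)
Definition log_unit n := up_log 2 ((9 * (d * n) + 6) %/ 7).

Definition start n := (n - (log_unit n).+3)%N.

Definition grows s : bool := `[< exists n, [/\ act n, (start n <= s)%N & (s.+1 < n)%N] >].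

(** Base 2 logarithm of a bound on the size of the list: it doubles when the list is squared, is 2
    at an active level with its three members, and 1 when there are two. *)
Fixpoint exponent s :=
  if s is s'.+1 then
    if grows s' then (2 * exponent s')%N
    else if act s then 2%N else if act s' then 1%N else exponent s'
  else 1%N.

Definition total_exponent m := (1 + \sum_(s < m) exponent s)%N.

Lemma act_ge13 n : act n -> (13 <= n)%N.
Proof.
move=> /act_large [n_gt0 H]; rewrite leqNgt; apply/negP => n13.
have {}H : (72 * (50 * n) <= 7 * 2 ^ n)%N.
  by apply: leq_trans H; rewrite leq_mul2l leq_mul2r d_ge50 !orbT.
have : (2 ^ n <= 512 * n)%N.
  have [n9|n9] := leqP n 9; first by apply: (@leq_trans (2 ^ 9)); rewrite ?leq_exp2l //; lia.
  by apply: (@leq_trans (2 ^ 12)); rewrite ?leq_exp2l //; lia.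
by clear - H n_gt0; lia.
Qed.

Lemma unit_lb n : (9 * (d * n) <= 7 * 2 ^ log_unit n)%N.
Proof. by have := @up_logP 2 ((9 * (d * n) + 6) %/ 7) isT; rewrite -/(log_unit n); lia. Qed.

Lemma unit_ub n : (0 < n)%N -> (7 * 2 ^ log_unit n < 18 * (d * n))%N.
Proof.
move=> n0; have dn : (50 <= d * n)%N by nia.
have /(@up_log_gtn 2 _ isT) : (1 < (9 * (d * n) + 6) %/ 7)%N by lia.
rewrite -/(log_unit n) => H.
have l0 : (0 < log_unit n)%N by rewrite up_log_gt0; lia.
have E : (2 ^ log_unit n = 2 * 2 ^ (log_unit n).-1)%N by rewrite -expnS prednK.
by rewrite E; lia.
Qed.

(** The hypothesis [72 * (d * n) <= 7 * 2 ^ n] says that [2 ^ (n - 3)] already passes the threshold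
    of [log_unit]. So the subtraction in [start] is not truncated, and [8 * u] cells of length
    [2 ^ start n] fill [2 ^ n] exactly. *)
Lemma start_eq n : act n -> (n = start n + (log_unit n).+3)%N.
Proof.
move=> an; have n13 := act_ge13 an; have [n0 H] := act_large an.
rewrite /start subnK // leqNgt; apply/negP => nl.
have ub := unit_ub n0.
have : (2 ^ n <= 2 ^ (log_unit n).+2)%N by rewrite leq_exp2l.
by rewrite !expnS; lia.
Qed.

Lemma start_lt n : act n -> (start n < n)%N.
Proof. by move/start_eq; lia. Qed.

(** [log_unit n] is logarithmic in [d * n], and [d <= 2 ^ m] because [m] is active; hence it is at
    most [5 + m + n / 8], little compared with [n >= 1000 * m]. *)
Lemma start_late m n : act m -> act n -> (m < n)%N ->
  (m.+2 <= start n)%N /\ (n <= 2 * start n)%N.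
Proof.
move=> am an mn; have m13 := act_ge13 am; have sp := act_sparse am an mn.
have nE := start_eq an; have [m0 Hm] := act_large am.
have n0 : (0 < n)%N by lia.
have dm : (d <= 2 ^ m)%N by nia.
have ub := unit_ub n0; set l := log_unit n in nE ub.
suff : (2 * l + 6 <= n)%N by lia.
have n8 : (n <= 8 * 2 ^ (n %/ 8))%N.
  by have := ltn_expl (n %/ 8) (isT : 1 < 2)%N; lia.
have lb : (2 ^ l <= 2 ^ (5 + m + n %/ 8))%N.
  apply: (@leq_trans (4 * (d * n))); first by lia.
  apply: (@leq_trans (4 * (2 ^ m * (8 * 2 ^ (n %/ 8))))); first by rewrite leq_mul2l leq_mul.
  by rewrite !expnD; lia.
by move: lb; rewrite leq_exp2l //; lia.
Qed.

Lemma start_before m n : act m -> act n -> (start n <= m)%N -> (n <= m)%N.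
Proof.
move=> am an sm; rewrite leqNgt; apply/negP => mn.
by have [] := start_late am an mn; lia.
Qed.

(** Such a level lies outside every interval from [start n] (excluded) to [n]; its list consists of
    two independent functionals. *)
Definition resting s := forall n, act n -> (start n < s)%N -> (n < s)%N.

Lemma resting_start n : act n -> resting (start n).
Proof.
move=> an m am lt; have [//|nm] := ltnP m (start n).
case: (ltngtP m n) => [mn|mn|mn].
- by have [] := start_late am an mn; lia.
- by have [] := start_late an am mn; have := start_lt an; lia.
by move: lt; rewrite mn ltnn.
Qed.

Lemma resting_succ s : resting s.+1 -> [/\ ~~ grows s, ~~ act s.+1 & act s \/ resting s].
Proof.
move=> rs; split.
- apply/negP => /asboolP [n [an sn ns]].
  by have := rs n an; rewrite ltnS => /(_ sn); lia.
- by apply/negP => as1; have := rs _ as1 (start_lt as1); rewrite ltnn.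
have [?|nas] := boolP (act s); [by left|right] => n an sn.
have := rs n an (ltnW sn); rewrite ltnS leq_eqVlt => /orP [/eqP E|//].
by move: nas; rewrite -E an.
Qed.

Lemma resting_after n : act n -> resting n.+1.
Proof. by move=> an m am; rewrite !ltnS; apply: start_before. Qed.

Lemma growsP n s : act n -> (start n <= s)%N -> (s.+1 < n)%N -> grows s.
Proof. by move=> an ns sn; apply/asboolP; exists n. Qed.

Lemma not_grows_pred n s : act n -> s.+1 = n -> ~~ grows s.
Proof.
move=> an sn; apply/negP => /asboolP [m [am ms sm]].
have := start_before an am; rewrite -sn => H.
by have := H (leqW ms); lia.
Qed.

Lemma exponent_resting s : resting s -> exponent s = 1%N.
Proof.
elim: s => //= s IH /resting_succ [/negPf -> /negPf -> H].
by case: ifP => // ns; apply: IH; case: H => // a; rewrite a in ns.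
Qed.

Lemma exponent_growing n s : act n -> (start n <= s)%N -> (s < n)%N ->
  exponent s = (2 ^ (s - start n))%N.
Proof.
move=> an /subnK <-; elim: (s - start n)%N => [|k IH] lt.
  by rewrite add0n subnn exponent_resting //; apply: resting_start.
rewrite addSn /= (growsP an) ?leq_addl // IH ?(ltnW lt) // subSn ?leq_addl //.
by rewrite expnS.
Qed.

Lemma exponent_act n : act n -> exponent n = 2%N.
Proof.
case: n => [/act_ge13 //|n an]; rewrite /= an.
by rewrite (negPf (not_grows_pred an erefl)).
Qed.

Lemma total_exponentS m : total_exponent m.+1 = (total_exponent m + exponent m)%N.
Proof. by rewrite /total_exponent big_ord_recr /= addnA. Qed.

Lemma total_exponent_resting m m' : (m <= m')%N ->
  (forall s, (m <= s < m')%N -> resting s) ->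
  total_exponent m' = (total_exponent m + (m' - m))%N.
Proof.
move=> /subnK <-; rewrite addnK; elim: (m' - m)%N => [|k IH] H; first by rewrite addn0.
rewrite addSn total_exponentS IH => [|s sk]; last by apply: H; lia.
by rewrite exponent_resting; [lia|apply: H; lia].
Qed.

Lemma total_exponent_growing n m : act n -> (start n <= m <= n)%N ->
  (total_exponent m < total_exponent (start n) + 2 ^ (m - start n))%N.
Proof.
move=> an /andP [/subnK <-]; elim: (m - start n)%N => [|k IH] lt.
  by rewrite add0n subnn addn1.
rewrite addSn total_exponentS (exponent_growing an) ?leq_addl //.
have := IH (ltnW lt); rewrite !addnK (_ : (k + start n).+1 - start n = k.+1)%N; last by lia.
by rewrite expnS; lia.
Qed.

Lemma pred_act n : (exists2 m, act m & (m < n)%N) ->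
  exists m, [/\ act m, (m < n)%N & forall s, act s -> (s < n)%N -> (s <= m)%N].
Proof.
case=> m am mn; pose p s := act s && (s < n)%N.
have ub s : p s -> (s <= n)%N by case/andP => _ /ltnW.
case: (ex_maxnP (ex_intro p m (introT andP (conj am mn))) ub) => s /andP [as1 sn] H.
by exists s; split => // t at1 tn; apply: H; apply/andP.
Qed.

(** Either no stage precedes, or earlier stages exceed the value [1 + start n] of constant exponents
    1 by at most [d * n / 20]. *)
Definition start_bound n := (total_exponent (start n) = (start n).+1) \/
  (n <= 2 * start n)%N /\ (20 * total_exponent (start n) <= 20 * start n + 20 + d * n)%N.

(** Relative to [d * m] the critical point is [m = n], where squaring has added less than
    [8 * u < 144 * d * n / 7]; 22 leaves room for the other levels. For [m < n] the added part is
    smaller by [2 ^ (n - m)], whereas [n <= m * 2 ^ (n - m)]. *)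
Lemma total_exponent_from n m : act n -> start_bound n -> (start n < m)%N ->
  (forall n', act n' -> (n < n')%N -> (m <= start n')%N) ->
  (total_exponent m <= 22 * (d * m))%N.
Proof.
move=> an sb nm next; have nE := start_eq an; have n13 := act_ge13 an.
have ub := unit_ub (leq_trans (isT : (0 < 13)%N) n13).
have pE : (2 ^ (n - start n) = 8 * 2 ^ log_unit n)%N.
  by rewrite [X in (2 ^ (X - _))%N]nE addKn !expnS; lia.
have dm : (50 * m <= d * m)%N by rewrite leq_mul2r d_ge50 orbT.
have dn : (50 * n <= d * n)%N by rewrite leq_mul2r d_ge50 orbT.
have [mn|mn] := leqP m n.
  have H := @total_exponent_growing n m an; rewrite (ltnW nm) mn in H; move/(_ isT): H => H.
  have E2 : (2 ^ (n - start n) = 2 ^ (m - start n) * 2 ^ (n - m))%N.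
    by rewrite -expnD; congr (2 ^ _)%N; lia.
  have n2 : (n <= m * 2 ^ (n - m))%N.
    have := ltn_expl (n - m) (isT : 1 < 2)%N; nia.
  have dn2 : (d * n <= d * m * 2 ^ (n - m))%N by rewrite -mulnA leq_mul2l n2 orbT.
  have H7 : (7 * 2 ^ (m - start n) <= 144 * (d * m))%N.
    rewrite -(@leq_pmul2r (2 ^ (n - m))) ?expn_gt0 // -mulnA -E2 pE.
    by rewrite -mulnA; lia.
  clear nE ub dn; case: sb => [E|[n2s H20]]; first by clear E2 n2 dn2 pE; lia.
  have dn2' : (d * n <= 2 * (d * m))%N.
    by rewrite mulnCA leq_mul2l; apply/orP; right; lia.
  by clear E2 n2 dn2 pE; lia.
have H := @total_exponent_growing n n an; rewrite leqnn (ltnW (start_lt an)) in H.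
move/(_ isT): H; rewrite pE => H.
have E : (total_exponent m = total_exponent n.+1 + (m - n.+1))%N.
  apply: total_exponent_resting => // s /andP [ns sm] n' an' sn'.
  case: (ltngtP n n') => [lt|lt|E]; last by rewrite -E.
    by have := next n' an' lt; lia.
  by lia.
have dnm : (d * n <= d * m)%N by rewrite leq_mul2l (ltnW mn) orbT.
rewrite E total_exponentS (exponent_act an).
by clear pE E nE; case: sb => [E'|[n2s H20]]; lia.
Qed.

Lemma total_exponent_start n : act n -> start_bound n.
Proof.
elim/ltn_ind: n => n IH an.
have [ex|nex] := pselect (exists2 m, act m & (m < n)%N); last first.
  left; rewrite (@total_exponent_resting 0) => [|//|s /andP [_ sn] m am ms].
    by rewrite /total_exponent big_ord0 subn0 addn0 add1n.
  case: (ltngtP m n) => [mn|mn|E]; first by case: nex; exists m.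
    by have [] := start_late an am mn; have := start_lt an; lia.
  by move: sn ms; rewrite E; lia.
have [m [am mn H]] := pred_act ex; right.
have [ms n2] := start_late am an mn; split => //.
have sp := act_sparse am an mn; have m13 := act_ge13 am.
have Hm : (total_exponent m.+2 <= 22 * (d * m.+2))%N.
  apply: (@total_exponent_from m) => //; first exact: IH.
    by have := start_lt am; lia.
  move=> n' an' mn'; have [nn'|n'n] := leqP n n'; last by have := H n' an' n'n; lia.
  by have [] := start_late am an' mn'; lia.
rewrite (@total_exponent_resting m.+2) => [|//|s /andP [ns sm] n' an' sn'].
  (* Here 440 is 20 times 22, and [1000 * m <= n] with [m >= 13] suffices. *)
  have : (440 * (d * m.+2) <= d * n)%N by rewrite mulnCA leq_mul2l; apply/orP; right; lia.
  by lia.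
case: (ltngtP n n') => [lt|lt|E].
- by have [] := start_late an an' lt; have := start_lt an; lia.
- by have := H n' an' lt; lia.
by move: sm sn'; rewrite E; lia.
Qed.

(** In logarithms the left side is at most [d * n] plus [d <= d * n / 13], plus [d * n / 10] from
    [2 * E], plus at most [4 * n <= 4 * d * n / 50]. The sum stays below 9/7 of [d * n]. *)
Lemma selection_budget n (N := start n) (E := total_exponent N) (l := log_unit n) :
  act n ->
  (2 ^ n.+1 * (2 ^ n.+1) ^ d * (2 ^ N * (2 ^ E * 2 ^ E)) * (16 * 2 ^ l) < 2 ^ 2 ^ l)%N.
Proof.
move=> an; have n13 := act_ge13 an; have sb := total_exponent_start an.
rewrite -[16%N]/(2 ^ 4)%N -!expnM -!expnD ltn_exp2l //.
have lb := unit_lb n; have nE := start_eq an; have Nn := start_lt an.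
have x50 : (50 * n <= d * n)%N by rewrite leq_mul2r d_ge50 orbT.
have x13 : (13 * d <= d * n)%N by rewrite mulnC leq_mul2l n13 orbT.
rewrite -/N -/l in lb nE Nn; rewrite [(n.+1 * d)%N]mulSn [(n * d)%N]mulnC.
by move: sb; rewrite /start_bound -/N -/E => -[EE|[_ EE]]; lia.
Qed.

Lemma total_exponent_leq m : (total_exponent m <= 22 * (d * m) + 1)%N.
Proof.
have [ex|nex] := pselect (exists n, act n && (start n < m)%N); last first.
  rewrite (@total_exponent_resting 0) => [|//|s /andP [_ sm] n an ns].
    by rewrite /total_exponent big_ord0; nia.
  by case: nex; exists n; rewrite an /=; lia.
have [n0 /andP [an0 nm0]] := ex.
have ub n : act n && (start n < m)%N -> (n <= n0 + 2 * m)%N.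
  move=> /andP [an nm]; have [|lt] := leqP n n0; first by lia.
  by have [] := start_late an0 an lt; lia.
have [n /andP [an nm] nmax] := ex_maxnP ex ub.
apply: leq_trans (leq_addr _ _).
apply: (total_exponent_from an) => //; first exact: total_exponent_start.
move=> n' an' nn'; rewrite leqNgt; apply/negP => lt.
by have := nmax n'; rewrite an' lt => /(_ isT); lia.
Qed.

End Schedule.

(** * The construction of the functionals *)

Section Construction.
Context {K : fieldType}.
Notation functional := (word -> K).
Variables (d : nat) (act : pred nat) (rel : nat -> seq functional).
Implicit Types (f g r : functional) (L : seq functional) (m n s k : nat).
Hypotheses (d_ge50 : (50 <= d)%N)
  (act_large : forall n, act n -> (0 < n)%N /\ (72 * (d * n) <= 7 * 2 ^ n)%N)
  (act_sparse : forall m n, act m -> act n -> (m < n)%N -> (1000 * m <= n)%N)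
  (rel_act : forall k r, r \in rel k ->
     exists2 n, act n & (12 * 2 ^ n < 8 * k <= 14 * 2 ^ n)%N)
  (size_rel : forall k, (size (rel k) <= k ^ d)%N).

Definition indep2 l f g := forall a b : K,
  (forall u, size u = l -> a * f u + b * g u = 0) -> a = 0 /\ b = 0.

Definition nonzero l f := exists2 w, size w = l & f w != 0.

(** Level [s.+2] will consist of the products of [a] with [b1] and [b2], so the fourfold product is
    any two adjacent members of it, the situation required by [kill_propagates]. *)
Definition selected s L : set (seq functional) := fun L' => exists a b1 b2,
  [/\ L' = [:: a; b1; b2],
      forall f, f \in L' -> span (2 ^ s.+1) (tens_list (2 ^ s) L L) f,
      nonzero (2 ^ s.+1) a, indep2 (2 ^ s.+1) b1 b2 &
      forall k r b b' x y, (12 * 2 ^ s.+1 < 8 * k <= 14 * 2 ^ s.+1)%N -> r \in rel k ->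
        b \in [:: b1; b2] -> b' \in [:: b1; b2] ->
        (size x + k + size y = 4 * 2 ^ s.+1)%N ->
        pairing k r (fun z => tens (2 ^ s.+1) a (tens (2 ^ s.+1) b
          (tens (2 ^ s.+1) a b')) (x ++ z ++ y)) = 0].

(* Where no selection exists, xget falls back on [::]; this keeps the sequence
   chained unconditionally, and selected_exists excludes it at active levels. *)
Definition next s L : seq functional :=
  if grows d act s then tens_list (2 ^ s) L L
  else if act s.+1 then xget [::] (selected s L)
  else if act s then [seq tens (2 ^ s) (head (fun=> 0) L) b | b <- behead L]
  else [seq tens (2 ^ s) (head (fun=> 0) L) b | b <- L].

Fixpoint level s : seq functional := if s is s'.+1 then next s' (level s')
  else [:: delta [:: ord0]; delta [:: ord_max]].

Lemma head_mem L f : f \in L -> head (fun=> 0) L \in L.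
Proof. by case: L => // g L _; rewrite inE eqxx. Qed.

Lemma level_chained : chained level.
Proof.
move=> s f; rewrite /= /next; case: ifP => _; first exact: span_mem.
case: ifP => _.
  by case: xgetP => [L' _ [a [b1 [b2 [_ H _ _ _]]]]|//]; apply: H.
case: ifP => _ /mapP [b bL ->].
  have bL' : b \in level s by move: bL; rewrite -drop1; exact: mem_drop.
  by apply: span_mem; apply/allpairsP; exists (head (fun=> 0) (level s), b); rewrite (head_mem bL').
by apply: span_mem; apply/allpairsP; exists (head (fun=> 0) (level s), b); rewrite (head_mem bL).
Qed.

Lemma size_level s : (size (level s) <= 2 ^ exponent d act s)%N.
Proof.
elim: s => [|s IH] //.
rewrite /= /next; case: ifP => _.
  by rewrite size_tens_list mul2n -addnn expnD leq_mul.
case: ifP => _.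
  by case: xgetP => [L' _ [a [b1 [b2 [-> _ _ _ _]]]]|].
case: ifP => as1; last by rewrite size_map.
rewrite size_map size_behead.
case: s as1 {IH} => [/(act_ge13 d_ge50 act_large) //|s as1].
rewrite /= /next (negPf (not_grows_pred d_ge50 act_large act_sparse as1 erefl)) as1.
by case: xgetP => [L' _ [a [b1 [b2 [-> _ _ _ _]]]]|].
Qed.

Lemma size_suffixes m l : (size (suffixes level m l) <= 2 ^ total_exponent d act m)%N.
Proof.
elim: m l => [|m IH] l.
  by rewrite /total_exponent big_ord0; case: l.
rewrite total_exponentS expnD /=; case: ifP => _.
  by apply: leq_trans (IH l) _; rewrite leq_pmulr // expn_gt0.
by rewrite size_tens_list leq_mul // size_level.
Qed.

Lemma size_prefixes m l : (size (prefixes level m l) <= 2 ^ total_exponent d act m)%N.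
Proof.
elim: m l => [|m IH] l.
  by rewrite /total_exponent big_ord0; case: l.
rewrite total_exponentS expnD mulnC /=; case: ifP => _.
  by apply: leq_trans (IH l) _; rewrite leq_pmull // expn_gt0.
by rewrite size_tens_list leq_mul // size_level.
Qed.

Lemma indep2_nonzero l f g : indep2 l f g -> nonzero l f.
Proof.
move=> fg; apply: contrapT => H; have [|/eqP] := fg 1 0; last by rewrite oner_eq0.
move=> w sw; rewrite mul0r addr0 mul1r; apply: contrapT => /eqP fw; apply: H.
by exists w.
Qed.

Lemma indep2_tens m a f g : nonzero m a -> indep2 m f g ->
  indep2 (m + m) (tens m a f) (tens m a g).
Proof.
move=> [v sv av] fg x y H; apply: fg => u su; apply: (mulfI av).
have := H (v ++ u); rewrite size_cat sv su => /(_ erefl).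
by rewrite /tens take_size_cat // drop_size_cat // mulr0 mulrDr ![a v * (_ * _)]mulrCA.
Qed.

(** * The selection at one active level *)

Section Stage.
Variable n : nat.
Hypothesis act_n : act n.
Let N := start d n.
Let u := (2 ^ log_unit d n)%N.
Let c := (2 ^ N)%N.
Variables (al be : functional).
Hypotheses (level_N : level N = [:: al; be]) (indep : indep2 c al be).
Let gam (i : 'I_2) : functional := nth (fun=> 0) (level N) i.

Lemma n_split : n = (N + (log_unit d n).+3)%N.
Proof. exact: (start_eq d_ge50 act_large act_n). Qed.

Lemma gam_mem i : gam i \in level N.
Proof. by rewrite mem_nth // level_N. Qed.

Lemma pow_n : (2 ^ n = c * (8 * u))%N.
Proof. by rewrite [X in (2 ^ X)%N]n_split expnD !expnS -/c -/u; lia. Qed.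

(** Squaring produces all words over the two cells, which is what lets an arbitrary combination of
    cell words be selected at level [n]. *)
Lemma level_evals s w : (N <= s)%N -> (s < n)%N -> size w = (2 ^ (s - N))%N ->
  exists2 f, f \in level s & forall X, size X = (2 ^ s)%N -> f X = eval c gam w X.
Proof.
move=> /subnK <-; elim: (s - N)%N w => [|k IH] w lt.
  rewrite add0n subnn; case: w => [|i [|]] // _.
  exists (gam i); first exact: gam_mem.
  by move=> X sX; rewrite /= /tens mulr1 take_oversize // sX.
rewrite addnK => sw.
have [||f fL fE] := IH (take (2 ^ k) w); first by lia.
  by rewrite addnK size_takel // sw leq_exp2l.
have [||g gL gE] := IH (drop (2 ^ k) w); first by lia.
  by rewrite addnK size_drop sw expnS; lia.
exists (tens (2 ^ (k + N)) f g).
  have gr : grows d act (k + N) by apply: (growsP act_n); [exact: leq_addl|lia].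
  rewrite addSn /= /next gr.
  by apply/allpairsP; exists (f, g).
move=> X; rewrite addSn expnS => sX; rewrite -[w in RHS](cat_take_drop (2 ^ k) w) eval_cat.
have -> : (c * size (take (2 ^ k) w) = 2 ^ (k + N))%N.
  by rewrite size_takel ?sw ?leq_exp2l // expnD mulnC.
by rewrite /tens fE ?gE // ?size_drop ?size_take_min sX; lia.
Qed.

Lemma span_inflate s G : s.+1 = n ->
  span (2 ^ n) (tens_list (2 ^ s) (level s) (level s)) (inflate c gam (8 * u) G).
Proof.
move=> sn; apply: span_sum => w; rewrite mem_words => /eqP sw.
have Ns : (N <= s)%N by have := n_split; lia.
have sE : (2 ^ (s - N) = 4 * u)%N.
  have -> : (s - N = (log_unit d n).+2)%N by have := n_split; lia.
  by rewrite !expnS -/u; lia.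
have [||f fL fE] := @level_evals s (take (4 * u) w) Ns; rewrite ?sn //.
  by rewrite sE size_takel // sw leq_mul2r orbT.
have [||g gL gE] := @level_evals s (drop (4 * u) w) Ns; rewrite ?sn //.
  by rewrite sE size_drop sw; lia.
apply: (span_ext (f := tens (2 ^ s) f g)).
  by apply: span_mem; apply/allpairsP; exists (f, g).
move=> X; rewrite -sn expnS => sX; rewrite -[w in LHS](cat_take_drop (4 * u) w) eval_cat.
have -> : (c * size (take (4 * u) w) = 2 ^ s)%N.
  by rewrite size_takel ?sw ?leq_mul2r ?orbT // -sE -expnD subnKC.
by rewrite /tens fE ?gE // ?size_drop ?size_take_min sX; lia.
Qed.

Let relators : seq (nat * functional) :=
  flatten [seq [seq (k, r) | r <- (if (12 * 2 ^ n < 8 * k <= 14 * 2 ^ n)%N then rel k else [::])]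
    | k <- iota 0 (2 ^ n.+1)].

Lemma mem_relators k r : ((k, r) \in relators) =
  (12 * 2 ^ n < 8 * k <= 14 * 2 ^ n)%N && (r \in rel k).
Proof.
apply/flattenP/andP => [[_ /mapP [k' _ ->] /mapP [r' + [-> ->]]]|[kn rk]].
  by case: ifP.
exists [seq (k, r) | r <- rel k]; last by apply: map_f.
by apply/mapP; exists k; rewrite ?kn // mem_iota expnS; lia.
Qed.

Lemma size_relators : (size relators <= 2 ^ n.+1 * (2 ^ n.+1) ^ d)%N.
Proof.
rewrite -[X in (_ <= X * _)%N](size_iota 0); apply: size_flatten_leq => k.
rewrite size_map; case: ifP => // kn; apply: leq_trans (size_rel k) _.
by rewrite leq_exp2r ?expnS; lia.
Qed.

Let RR := cell_contracts c gam (suffixes level N) (prefixes level N) relators.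

(** The ends can take almost two cells, but [k] exceeds [12 * u * c], so at most one complete cell
    is lost; hence [t.+1]. *)
Lemma RR_bounds t R : (t, R) \in RR -> (12 * u <= t.+1)%N /\ (t <= 14 * u)%N.
Proof.
have c_gt0 : (0 < c)%N by rewrite expn_gt0.
move=> /flattenP [_ /mapP [[k r] kr ->]] /flattenP [_ /mapP [l + ->]].
rewrite mem_iota /= => lc /allpairsP [[f g] /= [_ _ [-> _]]].
move: kr; rewrite mem_relators pow_n => /andP [/andP [k1 k2] _]; split.
  suff : (12 * u - 1 <= (k - l) %/ c)%N by lia.
  by rewrite leq_divRL //; nia.
by rewrite -ltnS ltn_divLR //; nia.
Qed.

Lemma size_RR : (size RR * (16 * u) < 2 ^ u)%N.
Proof.
have := selection_budget d_ge50 act_large act_sparse act_n.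
rewrite -/N -/u -/c; apply: leq_ltn_trans; rewrite leq_mul2r; apply/orP; right.
apply: leq_trans (leq_mul size_relators (leqnn _)).
apply: size_cell_contracts; first by rewrite expn_gt0.
by move=> l _; split; [exact: size_suffixes|exact: size_prefixes].
Qed.

Lemma selected_exists s : s.+1 = n -> exists L', selected s (level s) L'.
Proof.
move=> sn; have c_gt0 : (0 < c)%N by rewrite expn_gt0.
have u_gt0 : (0 < u)%N by rewrite expn_gt0.
have [a [b1 [b2 [[w [sw aw]] bb kill]]]] := selection u_gt0 RR_bounds size_RR.
have free := @inflate_free _ c gam (8 * u).
have gfree : forall x y, (forall v, size v = c -> x * gam ord0 v + y * gam ord_max v = 0) ->
    x = 0 /\ y = 0 by rewrite /gam level_N.
pose F := inflate c gam (8 * u).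
exists [:: F a; F b1; F b2], (F a), (F b1), (F b2); rewrite sn pow_n; split=> //.
- rewrite -pow_n => f; rewrite !inE => /or3P [] /eqP ->; exact: span_inflate.
- apply: contrapT => H; move/eqP: aw; apply; apply: (free a gfree) sw => X sX.
  by apply: contrapT => /eqP aX; apply: H; exists X.
- move=> x y H; apply: bb; apply: (free _ gfree) => X sX.
  rewrite -[RHS](H X sX) /F /inflate !big_distrr -big_split; apply: eq_bigr => v _ /=.
  by rewrite mulrDl !mulrA.
move=> k r b b' x y kn rk bm b'm sxy.
have lm b0 : b0 \in [:: F b1; F b2] -> exists2 b1', b1' \in [:: b1; b2] & b0 = F b1'.
  by rewrite !inE => /orP [] /eqP ->; [exists b1|exists b2]; rewrite ?inE ?eqxx ?orbT.
have [h hm ->] := lm _ bm; have [h' hm' ->] := lm _ b'm.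
pose G := tens (8 * u) a (tens (8 * u) h (tens (8 * u) a h')).
have GE : inflate c gam (32 * u) G = tens (c * (8 * u)) (F a) (tens (c * (8 * u)) (F h)
    (tens (c * (8 * u)) (F a) (F h'))).
  have lt (t1 t2 : nat) G1 G2 : inflate c gam (t1 + t2) (tens t1 G1 G2) =
      tens (c * t1) (inflate c gam t1 G1) (inflate c gam t2 G2).
    by apply/funext => X; rewrite inflate_tens.
  rewrite /G (_ : (32 * u = 8 * u + (8 * u + (8 * u + 8 * u)))%N); last by clear; lia.
  by rewrite !lt.
rewrite -GE; apply: (inflate_kill c_gt0 (SL := suffixes level N) (PL := prefixes level N)
  _ _ _ _ (DD := relators)) => //.
- by move=> i l; apply: (suffixesP level_chained); exact: gam_mem.
- by move=> i l; apply: (prefixesP level_chained); exact: gam_mem.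
- exact: suffixes0.
- exact: prefixes0.
- by move=> t R x' y' tR st; apply: kill tR hm hm' _.
- by rewrite mem_relators pow_n kn.
- by clear - kn u_gt0 c_gt0; nia.
by rewrite sxy; clear; lia.
Qed.

End Stage.

Lemma selected_level n : act n ->
  (exists al be, level (start d n) = [:: al; be] /\ indep2 (2 ^ start d n) al be) ->
  exists2 s, s.+1 = n & selected s (level s) (level n).
Proof.
move=> an [al [be [lN ab]]]; have n13 := act_ge13 d_ge50 act_large an.
exists n.-1; first by lia.
have E : n.-1.+1 = n by lia.
have ex := selected_exists an lN ab E.
have -> : level n = xget [::] (selected n.-1 (level n.-1)).
  rewrite -[in LHS]E /= /next E an.
  by rewrite (negPf (not_grows_pred d_ge50 act_large act_sparse an E)).
by case: xgetP => [//|/= H]; case: ex => L' /H.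
Qed.

Lemma level_succ_act n : act n -> level n.+1 =
  [seq tens (2 ^ n) (head (fun=> 0) (level n)) b | b <- behead (level n)].
Proof.
move=> an; have [/negPf ng /negPf na _] :=
  resting_succ d_ge50 act_large (resting_after d_ge50 act_large act_sparse an).
by rewrite /= /next ng na an.
Qed.

Lemma pow2S n : (2 ^ n.+1 = 2 ^ n + 2 ^ n)%N.
Proof. by rewrite expnS mul2n addnn. Qed.

(** Strong induction, because the level after an active [n] owes its independence to a selection
    whose input is the resting level [start n]. *)
Lemma level_resting s : resting d act s ->
  exists al be, level s = [:: al; be] /\ indep2 (2 ^ s) al be.
Proof.
elim/ltn_ind: s => -[_ _|s IH rs].
  exists (delta [:: ord0]), (delta [:: ord_max]); split => // a b H.
  split; [have := H [:: ord0] erefl|have := H [:: ord_max] erefl];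
    by rewrite /delta !eqxx ?mulr0 ?addr0 ?add0r mulr1.
have [/negPf ng /negPf na H] := resting_succ d_ge50 act_large rs.
have [as1|as1] := boolP (act s); last first.
  rewrite /= /next ng na (negPf as1).
  have [|al [be [-> ab]]] := IH s (ltnSn s); first by case: H as1 => // ->.
  exists (tens (2 ^ s) al al), (tens (2 ^ s) al be); split => //.
  by rewrite pow2S; apply: indep2_tens => //; exact: indep2_nonzero ab.
have [|s' s'E] := selected_level as1.
  apply: IH; last exact: (resting_start d_ge50 act_large act_sparse).
  by rewrite ltnS ltnW // (start_lt d_ge50 act_large).
rewrite /selected s'E => -[a [b1 [b2 [lE _ a0 b12 _]]]].
rewrite level_succ_act // lE /=; exists (tens (2 ^ s) a b1), (tens (2 ^ s) a b2).
by split => //; rewrite pow2S; apply: indep2_tens.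
Qed.

Lemma level_nonzero s : exists s' f, [/\ (s <= s')%N, f \in level s' & nonzero (2 ^ s') f].
Proof.
have [s' ss' rs] : exists2 s', (s <= s')%N & resting d act s'.
  have [rs|nrs] := pselect (resting d act s); first by exists s.
  have [n [an sn]] : exists n, act n /\ (s <= n)%N.
    apply: contrapT => H; apply: nrs => n an sn; rewrite ltnNge; apply/negP => ns.
    by apply: H; exists n.
  by exists n.+1; [exact: leqW|exact: (resting_after d_ge50 act_large act_sparse)].
have [al [be [lE ab]]] := level_resting rs.
by exists s', al; rewrite lE inE eqxx; split => //; exact: indep2_nonzero ab.
Qed.

Lemma level_kills k r s f x y : r \in rel k -> f \in level s ->
  (size x + k + size y = 2 ^ s)%N -> pairing k r (fun z => f (x ++ z ++ y)) = 0.
Proof.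
move=> rk; have [n an kn] := rel_act rk.
have [s' s'E] := selected_level an (level_resting (resting_start d_ge50 act_large act_sparse an)).
rewrite /selected s'E => -[a [b1 [b2 [lE _ a0 b12 kill]]]].
have lE1 : level n.+1 = [:: tens (2 ^ n) a b1; tens (2 ^ n) a b2].
  by rewrite level_succ_act // lE.
have H g h x' y' : g \in level n.+1 -> h \in level n.+1 ->
    (size x' + k + size y' = 2 ^ n.+2)%N ->
    pairing k r (fun z => tens (2 ^ n.+1) g h (x' ++ z ++ y')) = 0.
  rewrite lE1 => gm hm sxy.
  have mE p : p \in [:: tens (2 ^ n) a b1; tens (2 ^ n) a b2] ->
      exists2 b, b \in [:: b1; b2] & p = tens (2 ^ n) a b.
    by rewrite !inE => /orP [] /eqP ->; [exists b1|exists b2]; rewrite ?inE ?eqxx ?orbT.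
  have [b bm ->] := mE _ gm; have [b' bm' ->] := mE _ hm.
  rewrite (@tensA _ _ (2 ^ n) (2 ^ n)) ?pow2S //; apply: kill => //.
  by rewrite sxy !expnS mulnA.
(* Up to level [n] no window of length [k > 2 ^ n] fits; above [n.+1] the two-block case
   propagates. *)
case: (ltngtP s n.+1) => [sn|sn|->] fs sxy.
- have : (2 ^ s <= 2 ^ n)%N by rewrite leq_exp2l.
  by lia.
- apply: (kill_propagates level_chained _ H sn fs sxy).
  by rewrite expnS; lia.
(* A single block is reduced to two by appending a word [v] on which a member does not vanish, and
   dividing by its value. *)
have [v sv bv] : nonzero (2 ^ n.+1) (tens (2 ^ n) a b1).
  apply: (@indep2_nonzero _ _ (tens (2 ^ n) a b2)).
  by rewrite pow2S; apply: indep2_tens.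
apply: (mulfI bv); rewrite mulr0 -pairing_scale.
rewrite -(H f (tens (2 ^ n) a b1) x (y ++ v) fs); last 2 first.
- by rewrite lE1 inE eqxx.
- by rewrite size_cat sv addnA sxy [RHS]pow2S.
apply: pairing_ext => z sz; rewrite tens_left; last by rewrite sz; lia.
have -> : (2 ^ n.+1 - size x - size z = size y)%N by rewrite sz -sxy; lia.
by rewrite drop_size_cat // take_size_cat.
Qed.

End Construction.

(** * Dimension *)

Section Dimension.
Context {K : fieldType} {V : lmodType K}.
Implicit Types (W X : set V) (m n : nat).

Lemma lin_span_submod X : GRing.submod_closed [in lin_span X].
Proof.
split=> [|a x y /set_mem Xx /set_mem Xy]; apply/mem_set => W [sW XW].
  by apply/set_mem; exact: sW.1.
by apply/set_mem; apply: sW.2; apply/mem_set; [exact: Xx|exact: Xy].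
Qed.

Lemma lin_span_incl X : X `<=` lin_span X.
Proof. by move=> x Xx W [_]; apply. Qed.

Lemma lin_span_min X W : GRing.submod_closed [in W] -> X `<=` W -> lin_span X `<=` W.
Proof. by move=> sW XW x; apply. Qed.

Lemma submod_sum W (I : Type) (s : seq I) (F : I -> V) (a : I -> K) :
  GRing.submod_closed [in W] -> (forall i, W (F i)) -> W (\sum_(i <- s) a i *: F i).
Proof.
move=> [W0 Wlin] WF; elim: s => [|i s IH]; first by rewrite big_nil; apply: set_mem.
by rewrite big_cons; apply: set_mem; apply: Wlin; exact: mem_set.
Qed.

Lemma lin_span_range m (b : 'I_m -> V) x :
  lin_span (range b) x <-> exists a : 'I_m -> K, x = \sum_(i < m) a i *: b i.
Proof.
split=> [H|[a ->]]; last first.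
  apply: (@submod_sum (lin_span (range b))); first exact: lin_span_submod.
  by move=> i; apply: lin_span_incl; exists i.
pose W : set V := [set x | exists a : 'I_m -> K, x = \sum_(i < m) a i *: b i].
apply: (H W); split.
  split=> [|c y z /set_mem [a1 ->] /set_mem [a2 ->]]; apply/mem_set.
    by exists (fun=> 0); rewrite big1 // => i _; rewrite scale0r.
  exists (fun i => c * a1 i + a2 i); rewrite scaler_sumr -big_split.
  by apply: eq_bigr => i _; rewrite scalerDl scalerA.
move=> _ [i _ <-]; exists (fun j => (j == i)%:R); rewrite (bigD1 i) //= eqxx scale1r.
by rewrite big1 ?addr0 // => j /negPf ->; rewrite scale0r.
Qed.

Lemma lin_indep_extend m (b : 'I_m -> V) v : lin_indep b -> ~ lin_span (range b) v ->
  lin_indep (fun i : 'I_m.+1 => if unlift ord_max i is Some j then b j else v).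
Proof.
move=> bi nv a; rewrite big_ord_recr /= unlift_none.
have E (i : 'I_m) : unlift ord_max (widen_ord (leqnSn m) i) = Some i.
  have -> : widen_ord (leqnSn m) i = lift ord_max i.
    by apply: val_inj; rewrite /= /bump leqNgt ltn_ord.
  by rewrite liftK.
under eq_bigr do rewrite E.
have [a0|a0] := eqVneq (a ord_max) 0.
  rewrite a0 scale0r addr0 => /bi H i.
  case: (unliftP ord_max i) => [j ->|->] //; rewrite -(H j); congr a.
  by apply: val_inj; rewrite /= /bump leqNgt ltn_ord.
move=> H; case: nv; apply/lin_span_range.
exists (fun j => - (a ord_max)^-1 * a (widen_ord (leqnSn m) j)).
apply: (scalerI a0); rewrite scaler_sumr.
under eq_bigr do rewrite scalerA mulrA mulrN mulfV // mulN1r scaleNr.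
by rewrite sumrN; apply/eqP; rewrite -addr_eq0 addrC H.
Qed.

Lemma bounded_finite_dim W M : GRing.submod_closed [in W] ->
  (forall m (b : 'I_m -> V), lin_indep b -> (forall i, W (b i)) -> (m <= M)%N) ->
  finite_dim W.
Proof.
move=> sW H.
pose p m := `[< exists b : 'I_m -> V, lin_indep b /\ forall i, W (b i) >].
have p0 : p 0%N.
  apply/asboolP; exists (fun=> 0); split=> [a _ [] //|].
  by move=> _; apply: set_mem; exact: sW.1.
have pM m : p m -> (m <= M)%N by move=> /asboolP [b [bi bW]]; exact: H bi bW.
have [m /asboolP [b [bi bW]] mmax] := ex_maxnP (ex_intro p _ p0) pM.
exists m, b; split => //; apply/seteqP; split.
  by apply: lin_span_min => // _ [i _ <-].
move=> v Wv; apply: contrapT => nv; have : p m.+1; last by move/mmax; rewrite ltnn.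
apply/asboolP; eexists; split; first exact: (lin_indep_extend bi nv).
by move=> i /=; case: unlift => [j|]; [exact: bW|exact: Wv].
Qed.

Lemma leq_separating W (Fs : seq (V -> K)) m (b : 'I_m -> V) :
  GRing.submod_closed [in W] ->
  (forall F, F \in Fs -> forall (a : K) x y, F (a *: x + y) = a * F x + F y) ->
  (forall x, W x -> (forall F, F \in Fs -> F x = 0) -> x = 0) ->
  lin_indep b -> (forall i, W (b i)) -> (m <= size Fs)%N.
Proof.
move=> sW Flin F0 bi bW; rewrite leqNgt; apply/negP => lt.
pose F j := nth (fun=> 0) Fs j.
pose A : 'M[K]_(m, size Fs) := \matrix_(i, j) F j (b i).
have : kermx A != 0.
  rewrite kermx_eq0 -row_leq_rank -ltnNge; apply: leq_ltn_trans lt.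
  exact: rank_leq_col.
case/rowV0Pn => v /sub_kermxP vA /eqP; apply.
apply/rowP => i; rewrite mxE; apply: (bi (fun i => v 0 i)).
apply: F0 => [|G GF]; first exact: (@submod_sum W).
have G0 : G 0 = 0.
  have := Flin G GF 1 0 0; rewrite scaler0 addr0 mul1r => /eqP.
  by rewrite -subr_eq0 opprD addrA subrr sub0r oppr_eq0 => /eqP.
pose j := Ordinal (etrans (index_mem G Fs) GF : (index G Fs < size Fs)%N).
have := congr1 (fun M : 'rV_(size Fs) => M 0 j) vA; rewrite !mxE => <-.
apply: (big_ind2 (fun x y => G x = y)) => // [x y x' y' <- <-|k _].
  by have := Flin G GF 1 x x'; rewrite scale1r mul1r.
by have := Flin G GF (v 0 k) (b k) 0; rewrite !addr0 G0 addr0 !mxE /F /= nth_index.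
Qed.

End Dimension.

(** * The free algebra and its quotients *)

Lemma sum_mull (K : pzRingType) (L : lalgType K) (I : Type) (s : seq I)
    (c : I -> K) (F : I -> L) (x y : L) :
  (\sum_(i <- s) c i *: F i) * x * y = \sum_(i <- s) c i *: (F i * x * y).
Proof. by rewrite !mulr_suml; apply: eq_bigr => i _; rewrite -!scalerAl. Qed.

Lemma sum_mulr (K : pzRingType) (L : lalgType K) (I : Type) (s : seq I)
    (c : I -> K) (F : I -> L) (x y : L) :
  (forall a (u v : L), u * (a *: v) = a *: (u * v)) ->
  x * y * (\sum_(i <- s) c i *: F i) = \sum_(i <- s) c i *: (x * y * F i).
Proof. by move=> scaleAr; rewrite mulr_sumr; apply: eq_bigr => i _; rewrite scaleAr. Qed.

Lemma mulrD_eq0 (L : pzRingType) (a x y : L) : x = 0 -> y = 0 -> a * x + y = 0.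
Proof. by move=> -> ->; rewrite mulr0 addr0. Qed.

Lemma mulr_sub_mul (K : pzRingType) (L : lalgType K) (g r r' h : L) :
  g * (r - r') * h = (-1) *: (g * r' * h) + g * r * h.
Proof. by rewrite scaleN1r mulrBr mulrBl addrC. Qed.

Lemma mulr_regroup (L : pzRingType) (g a r b h : L) :
  g * (a * r * b) * h = (g * a) * r * (b * h).
Proof. by rewrite !mulrA. Qed.

Lemma mul_sum_mul (K : pzRingType) (L : lalgType K) (I : Type) (s : seq I)
    (c : I -> K) (F : I -> L) (x y : L) :
  (forall a (u v : L), u * (a *: v) = a *: (u * v)) ->
  x * (\sum_(i <- s) c i *: F i) * y = \sum_(i <- s) c i *: (x * F i * y).
Proof.
move=> scaleAr; rewrite mulr_sumr mulr_suml; apply: eq_bigr => i _.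
by rewrite scaleAr -scalerAl.
Qed.

Section FreeAlgebra.
Context {K : fieldType}.
Local Notation A := (free_alg2 K).
Notation functional := (word -> K).
Implicit Types (g h r : A) (x y w : word) (f : functional) (l n s : nat).

Definition monomial w : A := mkmalgU (FMonom w) 1.

Definition coefs r : functional := fun w => mcoeff (FMonom w) r.

Lemma monomialM x y : monomial x * monomial y = monomial (x ++ y).
Proof.
rewrite /monomial malgM_def fgmulUU mulr1; congr mkmalgU.
by apply/eqP; rewrite fmP fmM.
Qed.

Lemma monomial_nil : monomial [::] = 1.
Proof.
rewrite /monomial (_ : FMonom [::] = (mone : fmonom 'I_2)); first exact: mpolyC1E.
by apply/eqP; rewrite fmP fm1.
Qed.

Lemma coefs_monomial x w : coefs (monomial x) w = (x == w)%:R.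
Proof. by rewrite /coefs /monomial mcoeffU fmP. Qed.

Lemma coefs_lin a r r' w : coefs (a *: r + r') w = a * coefs r w + coefs r' w.
Proof. by rewrite /coefs mcoeffD mcoeffZ. Qed.

Lemma monomialE r : exists s : seq word, r = \sum_(w <- s) coefs r w *: monomial w.
Proof.
exists [seq fmonom_val k | k <- finmap.enum_fset (msupp r)]; rewrite big_map [LHS]monalgE.
apply: eq_bigr => k _; apply/malgP => k'.
by rewrite mcoeffZ !mcoeffU /coefs fmK; case: eqP => _; rewrite ?mulr1 ?mulr0.
Qed.

Lemma scale_mulr a r r' : r * (a *: r') = a *: (r * r').
Proof.
apply/malgP => k; rewrite mcoeffZ.
transitivity (\sum_(k1 <- finmap.enum_fset (msupp r)) \sum_(k2 <- finmap.enum_fset (msupp r'))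
    (mcoeff k1 r * mcoeff k2 (a *: r')) *+ (mmul k1 k2 == k)).
  exact: (mcoeffMlw k (finmap.fsubset_refl _) (msuppZ_le a r')).
rewrite [X in _ = a * X](mcoeffMl r r' k) big_distrr /=.
apply: eq_bigr => k1 _; rewrite big_distrr /=; apply: eq_bigr => k2 _.
by rewrite mcoeffZ mulrnAr mulrCA.
Qed.

Definition ev l f r : K := pairing l (coefs r) f.

Lemma ev_lin l f a r r' : ev l f (a *: r + r') = a * ev l f r + ev l f r'.
Proof.
rewrite /ev /pairing big_distrr -big_split; apply: eq_bigr => w _ /=.
by rewrite coefs_lin mulrDl mulrA.
Qed.

Lemma ev_sum l f (s : seq word) (c : word -> K) (F : word -> A) :
  ev l f (\sum_(w <- s) c w *: F w) = \sum_(w <- s) c w * ev l f (F w).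
Proof.
elim: s => [|w s IH]; last by rewrite !big_cons ev_lin IH.
rewrite !big_nil /ev /pairing big1 // => u _.
by rewrite /coefs mcoeff0 mul0r.
Qed.

Lemma ev_monomial l f w : ev l f (monomial w) = (size w == l)%:R * f w.
Proof.
rewrite /ev pairingE; case: eqP => [wl|wl]; last first.
  rewrite mul0r big1_seq // => u /andP [_]; rewrite mem_words => /eqP ul.
  by rewrite coefs_monomial; case: eqP => [E|_]; [case: wl; rewrite E|rewrite mul0r].
rewrite (bigD1_seq w) ?uniq_words ?mem_words ?wl //= coefs_monomial eqxx.
by rewrite big1 ?addr0 // => u /negPf uw; rewrite coefs_monomial eq_sym uw mul0r.
Qed.

Lemma ev_window n f x y r :
  (forall l, (size x + l + size y)%N = n -> ev l (fun u => f (x ++ u ++ y)) r = 0) ->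
  ev n f (monomial x * r * monomial y) = 0.
Proof.
have [s] := monomialE r; move: (coefs r) => c -> H.
have -> : monomial x * (\sum_(w <- s) c w *: monomial w) * monomial y =
    \sum_(w <- s) c w *: monomial (x ++ w ++ y).
  rewrite (mul_sum_mul _ _ _ _ _ scale_mulr); apply: eq_bigr => w _.
  by rewrite !monomialM catA.
rewrite ev_sum; have [le|lt] := leqP (size x + size y) n.
  have E : (size x + (n - size x - size y) + size y)%N = n by lia.
  rewrite -[RHS](H _ E) ev_sum; apply: eq_bigr => w _; rewrite !ev_monomial !size_cat.
  by congr (_ * (_%:R * _)); apply/eqP/eqP; lia.
rewrite big1 // => w _; rewrite ev_monomial !size_cat.
by case: eqP => [E|_]; [lia|rewrite mul0r mulr0].
Qed.

Lemma ev_high l f r : (forall w, size w = l -> coefs r w = 0) -> ev l f r = 0.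
Proof. by move=> H; rewrite /ev /pairing big1 // => w _; rewrite H ?size_tuple // mul0r. Qed.

Section Annihilator.
Variable P : nat -> seq functional.

Definition annihilated : set A := [set r | forall s f g h, f \in P s ->
  ev (2 ^ s) f (g * r * h) = 0].

Lemma annihilated_ideal : two_sided_ideal annihilated.
Proof.
split; last first.
  move=> a r b H s f g h fP.
  by rewrite (mulr_regroup (L := A)); apply: H.
split=> [|r r' /set_mem H /set_mem H']; apply/mem_set => s f g h fP.
  by rewrite mulr0 mul0r; apply: ev_high => w _; rewrite /coefs mcoeff0.
rewrite (mulr_sub_mul (L := A)) ev_lin.
exact: (mulrD_eq0 _ (H' s f g h fP) (H s f g h fP)).
Qed.

Lemma ideal_gen_annihilated : ideal_gen annihilated = annihilated.
Proof.
apply/seteqP; split=> r; last by move=> H M [_]; apply.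
by apply; split; first exact: annihilated_ideal.
Qed.

Lemma annihilated_ev s f r : annihilated r -> f \in P s -> ev (2 ^ s) f r = 0.
Proof. by move=> H fP; have := H s f 1 1 fP; rewrite mul1r mulr1. Qed.

(** For monomials [g] and [h], evaluating [f] on [g * r * h] reads [r] through a window of [f]; the
    general case is linear. *)
Lemma annihilatedP r : (forall s f x y l, f \in P s -> (size x + l + size y)%N = (2 ^ s)%N ->
    ev l (fun u => f (x ++ u ++ y)) r = 0) -> annihilated r.
Proof.
move=> H s f g h fP; have [sg ->] := monomialE g; have [sh ->] := monomialE h.
move: (coefs g) (coefs h) => cg ch.
rewrite (sum_mull (L := A)) ev_sum big1 // => x _.
rewrite (sum_mulr (L := A) _ _ _ _ _ scale_mulr) ev_sum big1 ?mulr0 // => y _.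
by rewrite ev_window ?mulr0 // => l; exact: H.
Qed.

End Annihilator.

End FreeAlgebra.

(** * Nonzero quotients as algebras, and induced maps *)

Section NonzeroQuotient.
Local Open Scope quotient_scope.
Context (K : pzRingType) (A : lalgType K) (X : set A).

(** The two proofs are parameters of the type so that the structures of nonzero ring and of algebra
    can be attached to it. *)
Definition nz_quot of 1 \notin ideal_pred X &
  (forall a (x y : A), x * (a *: y) = a *: (x * y)) := quot_alg X.
Variables (nz : 1 \notin ideal_pred X)
  (scaleAr : forall a (x y : A), x * (a *: y) = a *: (x * y)).
Local Notation Q := (nz_quot nz scaleAr).

HB.instance Definition _ := GRing.PzRing.on Q.
HB.instance Definition _ := GRing.Lmodule.on Q.

Lemma nz_quot_oner_neq0 : (1 : Q) != 0.
Proof.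
apply/negP => /eqP E; move/negP: nz; apply.
have p0 : \pi_(quot_alg X) 0 = 0.
  have := pi_quotD X 0 0; rewrite addr0 => E0.
  by apply: (addIr (\pi_(quot_alg X) 0)); rewrite add0r -E0.
by rewrite -[1]subr0; apply/quot_algP; rewrite p0; exact: E.
Qed.

HB.instance Definition _ := GRing.PzSemiRing_isNonZero.Build Q nz_quot_oner_neq0.

Lemma nz_quot_scalerAl (a : K) (x y : Q) : a *: (x * y) = (a *: x) * y.
Proof.
move: x y; elim/quotW => x; elim/quotW => y.
rewrite -[LHS]/(quot_scale a (quot_mul (\pi_(quot_alg X) x) (\pi_(quot_alg X) y))).
rewrite -[RHS]/(quot_mul (quot_scale a (\pi_(quot_alg X) x)) (\pi_(quot_alg X) y)).
by rewrite -pi_quotM -!pi_quotZ -pi_quotM scalerAl.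
Qed.

HB.instance Definition _ := GRing.Lmodule_isLalgebra.Build K Q nz_quot_scalerAl.

Lemma nz_quot_scalerAr (a : K) (x y : Q) : a *: (x * y) = x * (a *: y).
Proof.
move: x y; elim/quotW => x; elim/quotW => y.
rewrite -[LHS]/(quot_scale a (quot_mul (\pi_(quot_alg X) x) (\pi_(quot_alg X) y))).
rewrite -[RHS]/(quot_mul (\pi_(quot_alg X) x) (quot_scale a (\pi_(quot_alg X) y))).
by rewrite -pi_quotM -!pi_quotZ -pi_quotM scaleAr.
Qed.

HB.instance Definition _ := GRing.Lalgebra_isAlgebra.Build K Q nz_quot_scalerAr.

Definition nz_pi (r : A) : Q := \pi_(quot_alg X) r.

Lemma nz_pi_lin a r r' : nz_pi (a *: r + r') = a *: nz_pi r + nz_pi r'.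
Proof. by rewrite /nz_pi pi_quotD pi_quotZ. Qed.

Lemma nz_pi0 : nz_pi 0 = 0.
Proof. by have := nz_pi_lin (-1) 0 0; rewrite !scaleN1r !addNr. Qed.

Lemma nz_piM r r' : nz_pi (r * r') = nz_pi r * nz_pi r'.
Proof. exact: pi_quotM. Qed.

Lemma nz_pi_eqP r r' : nz_pi r = nz_pi r' <-> r - r' \in ideal_pred X.
Proof. by split=> [/(@quot_algP _ _ X)|H]; last exact/(@quot_algP _ _ X). Qed.

Lemma nz_pi_surj (b : Q) : exists r, b = nz_pi r.
Proof. by exists (repr (b : quot_alg X)); rewrite /nz_pi reprK. Qed.

Section InducedMap.
Variable Y : set A.
Hypothesis YX : {subset ideal_pred Y <= ideal_pred X}.

Definition induced_map (z : quot_alg Y) : Q := nz_pi (repr z).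

Lemma induced_mapE r : induced_map (\pi_(quot_alg Y) r) = nz_pi r.
Proof. by apply/nz_pi_eqP/YX; apply/quot_algP; rewrite reprK. Qed.

Lemma induced_map_linear : linear induced_map.
Proof.
move=> a x y; move: x y; elim/quotW => x; elim/quotW => y.
have -> : a *: \pi_(quot_alg Y) x + \pi_(quot_alg Y) y = \pi_(quot_alg Y) (a *: x + y).
  by rewrite pi_quotD pi_quotZ.
by rewrite !induced_mapE nz_pi_lin.
Qed.

Lemma induced_map_monoid_morphism : monoid_morphism induced_map.
Proof.
split; first exact: induced_mapE.
move=> x y; move: x y; elim/quotW => x; elim/quotW => y.
have -> : \pi_(quot_alg Y) x * \pi_(quot_alg Y) y = \pi_(quot_alg Y) (x * y).
  by rewrite pi_quotM.
by rewrite !induced_mapE nz_piM.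
Qed.

Lemma induced_map_surj : range induced_map = setT.
Proof.
apply/seteqP; split=> // b _; have [r ->] := nz_pi_surj b.
by exists (\pi_(quot_alg Y) r) => //; rewrite induced_mapE.
Qed.

End InducedMap.

End NonzeroQuotient.

(** * Growth of the quotient *)

(** The two sides of a cut give [44 * d * m] in the exponent; as [d >= 50], one more [d] absorbs
    both factors [L.+1] and the constants. *)
Lemma count_bound d L (E : nat -> nat) : (50 <= d)%N -> (0 < L)%N ->
  (forall m, (E m <= 22 * (d * m) + 1)%N) ->
  exists2 m, (L <= 2 ^ m)%N &
    (L.+1 * (L.+1 * (2 ^ E m * 2 ^ E m)) <= (4 * L) ^ (45 * d))%N.
Proof.
move=> d50 L0 HE; exists (up_log 2 L); first exact: up_logP.
set m := up_log 2 L.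
have Lm : (L <= 2 ^ m)%N by exact: up_logP.
have mL : (2 ^ m <= 2 * L)%N.
  have [L1|L1] := ltnP 1 L; last by rewrite /m (_ : L = 1)%N //; lia.
  have := @up_log_gtn 2 L isT L1; rewrite -/m => H.
  have m0 : (0 < m)%N by rewrite up_log_gt0.
  by rewrite -(prednK m0) expnS leq_mul2l ltnW.
have L1 : (L.+1 <= 2 ^ m.+1)%N by rewrite expnS; lia.
apply: (@leq_trans (2 ^ m.+1 * (2 ^ m.+1 * (2 ^ E m * 2 ^ E m)))).
  by rewrite !leq_mul.
apply: (@leq_trans ((2 ^ m.+1) ^ (45 * d))); last first.
  by rewrite leq_exp2r ?expnS; lia.
rewrite -!expnD -expnM leq_exp2l // mulSn.
have dm : (50 * m <= d * m)%N by rewrite leq_mul2r d50 orbT.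
by have := HE m; lia.
Qed.

Section Growth.
Local Open Scope quotient_scope.
Context {K : fieldType}.
Local Notation A := (free_alg2 K).
Variables (P : nat -> seq (word -> K)) (d : nat) (E : nat -> nat).
Hypotheses (chP : chained P) (d_ge50 : (50 <= d)%N)
  (E_leq : forall m, (E m <= 22 * (d * m) + 1)%N)
  (size_suf : forall m l, (size (suffixes P m l) <= 2 ^ E m)%N)
  (size_pre : forall m l, (size (prefixes P m l) <= 2 ^ E m)%N)
  (P_nonzero : forall s, exists s' f,
     [/\ (s <= s')%N, f \in P s' & nonzero (2 ^ s') f]).
Local Notation X := (annihilated P).

Definition degree_leq L (r : A) := forall w, (L < size w)%N -> coefs r w = 0.

Lemma degree_leq_widen L L' r : (L <= L')%N -> degree_leq L r -> degree_leq L' r.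
Proof. by move=> LL H w Lw; apply: H; apply: leq_ltn_trans Lw. Qed.

Lemma degree_leq_exists (r : A) : exists L, degree_leq L r.
Proof.
exists (\max_(k <- finmap.enum_fset (msupp r)) size (fmonom_val k))%N => w.
rewrite ltnNge => /negP H; apply: contrapT => /eqP cw; apply: H.
apply: (leq_bigmax_seq (FMonom w) (F := fun k => size (fmonom_val k)) (P := xpredT)) => //.
by rewrite -mcoeff_neq0.
Qed.

Lemma degree_leqM L L' (r r' : A) : degree_leq L r -> degree_leq L' r' ->
  degree_leq (L + L') (r * r').
Proof.
move=> H H' w lw; rewrite /coefs mcoeffMl big1 // => k1 _; rewrite big1 // => k2 _.
case: eqP => [kw|_]; last by rewrite mulr0n.
rewrite mulr1n; have [lt|le] := ltnP L (size (fmonom_val k1)).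
  by have := H _ lt; rewrite /coefs fmK => ->; rewrite mul0r.
have sw : size w = (size (fmonom_val k1) + size (fmonom_val k2))%N.
  by rewrite -size_cat -fmM kw.
have lt : (L' < size (fmonom_val k2))%N by lia.
by have := H' _ lt; rewrite /coefs fmK => ->; rewrite mulr0.
Qed.

Lemma ev_degree L l f (r : A) : degree_leq L r -> (L < l)%N -> ev l f r = 0.
Proof. by move=> H Ll; apply: ev_high => w wl; apply: H; rewrite wl. Qed.

(** A functional on words of length [2 ^ s > L] vanishes in degrees at most [L] but not on a
    suitable word; hence the quotient is infinite dimensional. *)
Lemma monomial_not_congruent L : exists w, forall r : A, degree_leq L r ->
  ~ annihilated P (monomial w - r).
Proof.
have [s [f [Ls fP [w sw fw]]]] := P_nonzero L; exists w => r H Ew.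
have := annihilated_ev Ew fP.
rewrite (_ : monomial w - r = (-1) *: r + monomial w); last by rewrite scaleN1r addrC.
rewrite ev_lin ev_monomial sw eqxx mul1r (@ev_degree L) ?mulr0 ?add0r //.
  by move=> f0; rewrite f0 eqxx in fw.
by apply: leq_ltn_trans Ls _; exact: ltn_expl.
Qed.

Lemma annihilated_neq1 : (1 : A) \notin ideal_pred X.
Proof.
rewrite /ideal_pred ideal_gen_annihilated; apply/negP => /set_mem /= H.
have d0 : degree_leq 0 (0 : A) by move=> w _; rewrite /coefs mcoeff0.
have [w /(_ 0 d0) []] := monomial_not_congruent 0.
have := annihilated_ideal P => -[_ /(_ (monomial w) 1 1 H)].
by rewrite !mulr1 subr0.
Qed.

Local Notation Q := (nz_quot annihilated_neq1 scale_mulr).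
Local Notation piQ := (nz_pi annihilated_neq1 scale_mulr).

Lemma piQ_eqP r r' : piQ r = piQ r' <-> annihilated P (r - r').
Proof.
have rr : (r - r' \in ideal_pred X) <-> annihilated P (r - r').
  rewrite /ideal_pred ideal_gen_annihilated.
  by split=> [/set_mem|/mem_set].
by split=> [/nz_pi_eqP/rr|/rr H]; last exact/nz_pi_eqP.
Qed.

Definition bounded L : set Q := [set b | exists2 r, b = piQ r & degree_leq L r].

Lemma bounded_submod L : GRing.submod_closed [in bounded L].
Proof.
split=> [|a x y /set_mem [r -> H] /set_mem [r' -> H']]; apply/mem_set.
  by exists 0; [rewrite nz_pi0|move=> w _; rewrite /coefs mcoeff0].
exists (a *: r + r'); first by rewrite nz_pi_lin.
by move=> w Lw; rewrite coefs_lin H // H' // mulr0 addr0.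
Qed.

Lemma bounded_widen L L' : (L <= L')%N -> bounded L `<=` bounded L'.
Proof. by move=> LL _ [r -> H]; exists r => //; exact: degree_leq_widen H. Qed.

Lemma bounded_mul_space L L' (S S' : set Q) : S `<=` bounded L -> S' `<=` bounded L' ->
  mul_space S S' `<=` bounded (L + L').
Proof.
move=> SL SL'; apply: lin_span_min; first exact: bounded_submod.
move=> _ [x /SL [r -> H]] [y /SL' [r' -> H']] <-.
by exists (r * r'); rewrite ?nz_piM //; exact: degree_leqM.
Qed.

Lemma bounded_pow_space L S n : S `<=` bounded L -> pow_space S n `<=` bounded (L * n).
Proof.
move=> SL; elim: n => [|n IH]; last by rewrite mulnS; exact: bounded_mul_space.
rewrite muln0; apply: lin_span_min; first exact: bounded_submod.
move=> _ ->; exists 1 => // w sw; rewrite -monomial_nil coefs_monomial.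
by case: w sw.
Qed.

(** Indexed by the length and the cut of a window. By [windows_bounded] they detect membership in
    the ideal for elements of degree at most [L]. *)
Definition separators m L : seq (A -> K) :=
  flatten [seq flatten [seq [seq ev l f
      | f <- tens_list l1 (suffixes P m l1) (prefixes P m (l - l1))]
    | l1 <- iota 0 L.+1] | l <- iota 0 L.+1].

Lemma size_separators m L :
  (size (separators m L) <= L.+1 * (L.+1 * (2 ^ E m * 2 ^ E m)))%N.
Proof.
rewrite -[X in (_ <= X * _)%N](size_iota 0); apply: size_flatten_leq => l.
rewrite -[X in (_ <= X * _)%N](size_iota 0); apply: size_flatten_leq => l1.
by rewrite size_map size_tens_list leq_mul.
Qed.

Lemma separatorsP m L r : (L <= 2 ^ m)%N -> degree_leq L r ->
  (forall F, F \in separators m L -> F r = 0) -> annihilated P r.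
Proof.
move=> Lm rL H; apply: annihilatedP => s f x y l fP sxy.
have [lL|Ll] := leqP l L; last exact: ev_degree Ll.
have [||l1 l1l W] := @windows_bounded _ _ chP m s (size x) l; [lia|lia|].
apply: (pairing_span (W f fP x y erefl sxy)) => g gP.
apply: (H (ev l g)); apply/flattenP; eexists.
  by apply: map_f; rewrite mem_iota; exact: (leq_ltn_trans lL).
apply/flattenP; exists [seq ev l f | f <- tens_list l1 (suffixes P m l1) (prefixes P m (l - l1))].
  by apply/mapP; exists l1; rewrite // mem_iota /=; lia.
exact: map_f.
Qed.

Lemma has_dim_bounded L W n : (0 < L)%N -> W `<=` bounded L -> has_dim W n ->
  (n <= (4 * L) ^ (45 * d))%N.
Proof.
move=> L0 WL [b [bi bW]].
have [m Lm /(leq_trans _)] := count_bound d_ge50 L0 E_leq; apply.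
apply: leq_trans (size_separators m L).
have /choice [r rP] : forall i, exists r, b i = piQ r /\ degree_leq L r.
  move=> i; have /WL [r rE rL] : W (b i) by rewrite -bW; apply: lin_span_incl; exists i.
  by exists r.
have piQ_sum (a : 'I_n -> K) : piQ (\sum_(i < n) a i *: r i) = \sum_(i < n) a i *: b i.
  elim/big_rec2: _ => [|i y1 y2 _ <-]; first exact: nz_pi0.
  by rewrite nz_pi_lin (rP i).1.
have ri : lin_indep r by move=> a a0; apply: bi; rewrite -piQ_sum a0 nz_pi0.
apply: (@leq_separating _ _ (lin_span (range r)) _ _ r) => //.
- exact: lin_span_submod.
- move=> F /flattenP [_ /mapP [l _ ->]] /flattenP [_ /mapP [l1 _ ->]] /mapP [f _ ->] a x y.
  exact: ev_lin.
- move=> x /lin_span_range [a ->] xF.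
  have a0 : forall i, a i = 0.
    apply: bi; rewrite -piQ_sum -nz_pi0; apply/piQ_eqP; rewrite subr0.
    apply: (separatorsP Lm) xF => w Lw.
    elim/big_rec: _ => [|i x' _ xw]; first by rewrite /coefs mcoeff0.
    by rewrite coefs_lin xw (rP i).2 // mulr0 addr0.
  by rewrite big1 // => i _; rewrite a0 scale0r.
by move=> i; apply: lin_span_incl; exists i.
Qed.

Lemma finite_dim_bounded (S : set Q) : finite_dim S -> exists L, S `<=` bounded L.
Proof.
move=> [n [b [_ <-]]].
have /choice [l lP] : forall i, exists L, bounded L (b i).
  move=> i; have [r ->] := nz_pi_surj (b i); have [L rL] := degree_leq_exists r.
  by exists L, r.
exists (\max_(i < n) l i)%N; apply: lin_span_min; first exact: bounded_submod.
by move=> _ [i _ <-]; apply: bounded_widen (lP i); exact: leq_bigmax.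
Qed.

Lemma quotient_infinite_dim : ~ finite_dim [set: Q].
Proof.
move=> /finite_dim_bounded [L TL].
have [w nw] := monomial_not_congruent L.
have [r rE rL] : bounded L (piQ (monomial w)) by exact: TL.
by apply: (nw r rL); apply/piQ_eqP.
Qed.

Lemma growth_bounded (S : set Q) L n : (0 < L)%N -> S `<=` bounded L -> (0 < n)%N ->
  (growth S n <= (4 * L * n) ^ (45 * d))%N.
Proof.
move=> L0 SL n0; rewrite /growth /dim; case: xgetP => [m _|//]; rewrite -mulnA.
apply: has_dim_bounded; first by rewrite muln_gt0 L0.
apply: lin_span_min; first exact: bounded_submod.
move=> b [i /= ilt] /(bounded_pow_space SL); apply: bounded_widen.
by rewrite leq_mul2l -ltnS ilt orbT.
Qed.

Lemma GKdim_quotient (R : realType) : (GKdim R Q <= (45 * d)%N%:R%:E)%E.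
Proof.
rewrite /GKdim; set S := xget _ _.
have [L [L0 SL]] : exists L, (0 < L)%N /\ S `<=` bounded L.
  rewrite /S; case: xgetP => [S' _ [/finite_dim_bounded [L SL] _]|_].
    by exists L.+1; split => //; apply: subset_trans SL (bounded_widen _).
  (* The default value of [xget] is the empty set. *)
  by exists 1%N; split => // x [].
apply: ereal_inf_lbound; exists (45 * d)%N%:R => //.
exists (4 * L)%N; first by rewrite muln_gt0.
move=> n n1; rewrite powR_mulrn ?ler0n // -natrX ler_nat.
exact: growth_bounded.
Qed.

End Growth.

(** * The relators *)

Section Relators.
Context {K : fieldType}.
Local Notation A := (free_alg2 K).
Implicit Types (W : set A) (k : nat).

Lemma word_space_coefs k (r : A) w : word_space K k r -> size w <> k -> coefs r w = 0.
Proof.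
move=> rk wk; pose W : set A := [set r | coefs r w = 0].
suff : word_space K k `<=` W by apply.
apply: lin_span_min => [|_ [u uk <-]].
  split=> [|a x y /set_mem xw /set_mem yw]; apply/mem_set.
    by rewrite /W /= /coefs mcoeff0.
  by rewrite /W /= coefs_lin xw yw mulr0 addr0.
rewrite /W /= -(fmK u) -/(monomial _) coefs_monomial; case: eqP => // uw.
by case: wk; rewrite -uw -uk.
Qed.

Lemma ev_delta k (r : A) w : size w = k -> ev k (delta w) r = coefs r w.
Proof.
move=> wk; rewrite /ev pairingE (bigD1_seq w) ?uniq_words ?mem_words ?wk //=.
rewrite /delta eqxx mulr1 big1 ?addr0 // => u /negPf ->.
by rewrite mulr0.
Qed.

Lemma subspace_has_dim k W : GRing.submod_closed [in W] -> W `<=` word_space K k ->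
  has_dim W (dim W).
Proof.
move=> sW Wk; suff [n Wn] : finite_dim W.
  by rewrite /dim; case: xgetP => [m _ //|/(_ n)].
apply: (@bounded_finite_dim _ _ _ (2 ^ k)) => // m b bi bW.
rewrite -(size_words k) -(size_map (fun w => @ev K k (delta w))).
apply: (leq_separating sW) bi bW => [F /mapP [w _ ->] a x y|x Wx H].
  exact: ev_lin.
apply/malgP => u; rewrite mcoeff0 -(fmK u) -/(coefs x _).
have [uk|uk] := eqVneq (size (fmonom_val u)) k; last first.
  by apply: (word_space_coefs (Wk _ Wx)); exact/eqP.
by rewrite -(ev_delta _ uk); apply/H/map_f; rewrite mem_words uk.
Qed.

(** The list is a basis of [W], but empty for [W = 0]: a member then certifies that [D k] is
    nonzero, so that hypotheses (1) to (3) restrict [k]. *)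
Lemma relators_exist k n W : GRing.submod_closed [in W] -> W `<=` word_space K k ->
  (dim W <= n)%N -> exists L : seq (word -> K),
    [/\ (size L <= n)%N, L <> [::] -> W <> [set 0] &
        forall r f, W r -> (forall g, g \in L -> pairing k g f = 0) -> ev k f r = 0].
Proof.
move=> sW Wk Wn; have [W0|W0] := pselect (W = [set 0]).
  exists [::]; split=> // r f; rewrite W0 => -> _; apply: ev_high => w _.
  by rewrite /coefs mcoeff0.
have [b [_ bW]] := subspace_has_dim sW Wk.
exists [seq coefs (b i) | i <- enum 'I_(dim W)]; split=> //.
  by rewrite size_map size_enum_ord.
move=> r f Wr H; have /lin_span_range [a ->] : lin_span (range b) r by rewrite bW.
elim/big_rec: _ => [|i x _ xf]; first by apply: ev_high => w _; rewrite /coefs mcoeff0.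
rewrite ev_lin xf addr0; apply/eqP; rewrite mulf_eq0; apply/orP; right; apply/eqP.
by apply: H; apply: map_f; rewrite mem_enum.
Qed.

End Relators.

Lemma exp_sparse e m n j k : (2 ^ m <= j)%N -> (j ^ e <= k)%N -> (k < 2 ^ n.+1)%N ->
  (e * m <= n)%N.
Proof.
move=> mj jk kn; rewrite -ltnS -(@ltn_exp2l 2) // mulnC expnM.
by apply: leq_ltn_trans kn; apply: leq_trans jk; case: (posnP e) => [->//|e0]; rewrite leq_exp2r.
Qed.

Lemma log2_lower_bound (R : realType) d n k : (2 ^ n <= k)%N -> (2 <= k)%N ->
  ~ (k%:R / log2 k%:R < (18 * d)%N%:R :> R) -> (18 * (d * n) <= k)%N.
Proof.
move=> nk k2 /negP; rewrite -leNgt => H.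
have ln2 : 0 < ln 2%:R :> R by rewrite ln_gt0 // ltr1n.
have lk : (n%:R <= log2 k%:R :> R).
  rewrite /log2 ler_pdivlMr // mulrC mulr_natr -lnXn ?ltr0n // -natrX.
  by rewrite ler_ln ?posrE ?ltr0n ?expn_gt0 // ?ler_nat //; lia.
have l0 : 0 < log2 k%:R :> R by rewrite /log2 divr_gt0 // ln_gt0 // ltr1n.
rewrite ler_pdivlMr // in H.
have : ((18 * d) * n)%N%:R <= k%:R :> R.
  by rewrite natrM; apply: le_trans H; rewrite ler_wpM2l.
by rewrite ler_nat mulnA.
Qed.

(** Between [2 ^ n] and [2 ^ n.+1] the excluded interval of [n] removes the lower half and that of
    [n.+1] the top quarter. *)
Lemma dyadic_gap (R : realType) k : (2 <= k)%N ->
  (forall n : nat, ~ (2 ^+ n - 2 ^ (n%:Z - 3) < (k%:R : R) <= 2 ^+ n + 2 ^ (n%:Z - 1))) ->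
  exists2 n, (2 ^ n <= k < 2 ^ n.+1)%N & (12 * 2 ^ n < 8 * k <= 14 * 2 ^ n)%N.
Proof.
move=> k2 H; pose n := trunc_log 2 k.
have /andP [nk kn] : (2 ^ n <= k < 2 ^ n.+1)%N by apply: trunc_log_bounds => //; lia.
exists n; first by rewrite nk kn.
have two0 : (2 : R) != 0 by rewrite pnatr_eq0.
have e3 m : 2 ^ (m%:Z - 3) = (2 ^ m)%N%:R / 8%:R :> R.
  by rewrite expfzDr // -exprnP natrX; congr (_ * _^-1); rewrite -natrX.
have e1 m : 2 ^ (m%:Z - 1) = (2 ^ m)%N%:R / 2%:R :> R.
  by rewrite expfzDr // -exprnP natrX.
have H1 := H n; have H2 := H n.+1; rewrite !e3 !e1 -!natrX in H1 H2.
have cast (a b : nat) : (a <= b)%N -> a%:R <= b%:R :> R by rewrite ler_nat.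
have x0 : (0 : R) < (2 ^ n)%N%:R by rewrite ltr0n expn_gt0.
have nkR := cast _ _ nk.
have knR : k%:R < (2 ^ n.+1)%N%:R :> R by rewrite ltr_nat.
rewrite expnS natrM in H2 knR.
apply/andP; split.
  rewrite ltnNge; apply/negP => /cast; rewrite !natrM => le.
  by apply: H1; apply/andP; split; lra.
rewrite leqNgt; apply/negP => lt.
have {}lt : (14 * 2 ^ n)%N%:R < (8 * k)%N%:R :> R by rewrite ltr_nat.
rewrite !natrM in lt; apply: H2; apply/andP; split; lra.
Qed.

(** * Assembly of the infinite dimensional image *)

Lemma infinite_image (R : realType) (K : fieldType) (d : nat)
    (D : nat -> set (free_alg2 K)) (act : pred nat) (rel : nat -> seq (word -> K)) :
  (50 <= d)%N ->
  (forall n, act n -> (0 < n)%N /\ (72 * (d * n) <= 7 * 2 ^ n)%N) ->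
  (forall m n, act m -> act n -> (m < n)%N -> (1000 * m <= n)%N) ->
  (forall k r, r \in rel k ->
     exists2 n, act n & (12 * 2 ^ n < 8 * k <= 14 * 2 ^ n)%N) ->
  (forall k, (size (rel k) <= k ^ d)%N) ->
  (forall k, D k `<=` word_space K k) ->
  (forall k r f, D k r -> (forall g, g \in rel k -> pairing k g f = 0) -> ev k f r = 0) ->
  exists (B : algType K) (f : quot_alg (\bigcup_k D k) -> B),
    [/\ linear f, monoid_morphism f, range f = setT,
        ~ finite_dim [set: B] & (GKdim R B <= (45 * d)%N%:R%:E)%E].
Proof.
move=> d50 act_large act_sparse rel_act size_rel Dk rel_span.
pose P := level d act rel.
have chP : chained P by exact: level_chained.
have size_suf m l := size_suffixes rel d50 act_large act_sparse m l.
have size_pre m l := size_prefixes rel d50 act_large act_sparse m l.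
have P_nz := level_nonzero d50 act_large act_sparse size_rel.
have E_leq := total_exponent_leq d50 act_large act_sparse.
have D_ann r k : D k r -> annihilated P r.
  move=> Dr; apply: annihilatedP => s f x y l fP sxy.
  have [lk|lk] := eqVneq l k; last first.
    by apply: ev_high => w wl; apply: (word_space_coefs (Dk _ _ Dr)); rewrite wl; exact/eqP.
  rewrite lk in sxy *; apply: rel_span Dr _ => g gk.
  exact: (level_kills d50 act_large act_sparse rel_act size_rel gk fP sxy).
have sub : {subset ideal_pred (\bigcup_k D k) <= ideal_pred (annihilated P)}.
  move=> r /set_mem H; apply/mem_set; rewrite ideal_gen_annihilated.
  by apply: H; split; [exact: annihilated_ideal|move=> x [k _ /D_ann]].
exists (nz_quot (annihilated_neq1 P_nz) scale_mulr).
exists (@induced_map _ _ _ (annihilated_neq1 P_nz) scale_mulr (\bigcup_k D k)).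
split.
- exact: induced_map_linear.
- exact: induced_map_monoid_morphism.
- exact: induced_map_surj.
- exact: quotient_infinite_dim.
exact: (GKdim_quotient chP d50 E_leq size_suf size_pre).
Qed.

Theorem theorem1 (R : realType) (K : closedFieldType) (d : nat)
    (D : nat -> set (free_alg2 K)) :
  (50 <= d)%N ->
  (forall k, GRing.submod_closed [in D k] /\ D k `<=` word_space K k) ->
  (forall k, (2 <= k)%N -> k%:R / log2 k%:R < (18 * d)%N%:R :> R ->
     D k = [set 0]) ->
  (forall k, (exists n : nat,
      2 ^+ n - 2 ^ (n%:Z - 3) < (k%:R : R) <= 2 ^+ n + 2 ^ (n%:Z - 1)) ->
     D k = [set 0]) ->
  (forall k, (exists j n : nat, D j <> [set 0] /\
      (j < 2 ^ n < k)%N /\ (k < maxn (j ^ 1000) (12 * d * n * j))%N) ->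
     D k = [set 0]) ->
  (forall k, (dim (D k) <= k ^ d)%N) ->
  exists (B : algType K) (f : quot_alg (\bigcup_k D k) -> B),
    [/\ linear f, monoid_morphism f, range f = setT,
        ~ finite_dim [set: B] & (GKdim R B <= (45 * d)%N%:R%:E)%E].
Proof.
move=> d50 Dsub D1 D2 D3 D4.
have [rel relP] := choice (fun k => relators_exist (Dsub k).1 (Dsub k).2 (D4 k)).
pose act : pred nat := fun n =>
  `[< exists2 k, D k <> [set 0] & (12 * 2 ^ n < 8 * k <= 14 * 2 ^ n)%N >].
have not_dyadic k : D k <> [set 0] -> forall n : nat,
    ~ (2 ^+ n - 2 ^ (n%:Z - 3) < (k%:R : R) <= 2 ^+ n + 2 ^ (n%:Z - 1)).
  by move=> Dk n H; apply: Dk; apply: D2; exists n.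
have ge2 k : rel k <> [::] -> (2 <= k)%N.
  move=> rk; have [sk /(_ rk) Dk _] := relP k.
  (* For [k = 0] the dimension is at most [0 ^ d = 0]; [k = 1] lies in the excluded interval of
     [n = 0]. *)
  case: k rk sk Dk => [|[|//]] rk sk Dk.
    by case: rk; apply/size0nil/eqP; rewrite -leqn0 (leq_trans sk) // exp0n //; lia.
  exfalso; apply: (not_dyadic _ Dk 0%N).
  by rewrite expr0 ltrBlDr ltrDl lerDl ltW !exprz_gt0.
have large k n : D k <> [set 0] -> (2 ^ n <= k)%N -> (2 <= k)%N -> (18 * (d * n) <= k)%N.
  move=> Dk nk k2; apply: (log2_lower_bound (R := R) nk k2) => H.
  by apply: Dk; exact: D1.
apply: (@infinite_image R K d D act rel) => //.
- move=> n /asboolP [k Dk kn]; have n0 : (0 < n)%N.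
    by case: n kn => [|//]; rewrite expn0; lia.
  split=> //; have := large k n Dk; have : (2 ^ 1 <= 2 ^ n)%N by rewrite leq_exp2l.
  by rewrite expn1; lia.
- move=> m n /asboolP [j Dj jm] /asboolP [k Dk kn] mn.
  have mn2 : (2 ^ m.+1 <= 2 ^ n)%N by rewrite leq_exp2l.
  rewrite expnS in mn2.
  (* Since [j < 2 ^ m.+1 <= 2 ^ n < k], hypothesis (3) applies with this [n]. *)
  have jk : (j ^ 1000 <= k)%N.
    rewrite leqNgt; apply/negP => kj; apply: Dk; apply: D3; exists j, n; split=> //.
    by rewrite leq_max kj; split => //; lia.
  by apply: (exp_sparse _ jk); rewrite ?expnS; lia.
- move=> k r rk; have rk0 : rel k <> [::] by move=> r0; rewrite r0 in rk.
  have [_ /(_ rk0) Dk _] := relP k.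
  have [n _ kn] := dyadic_gap (ge2 _ rk0) (not_dyadic _ Dk).
  by exists n => //; apply/asboolP; exists k.
- by move=> k; have [] := relP k.
- by move=> k; exact: (Dsub k).2.
by move=> k r f; have [_ _] := relP k; apply.
Qed.
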